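(* Let $\omega$ be a non-quasianalytic subadditive weight function. For every $w=(y,\eta)\in\mathbb{R}^{2d}$ and every $u\in\mathcal{S}'_\omega(\mathbb{R}^d)$ we have $$\mathrm{WF}'_\omega(\Pi(w)u)=\mathrm{WF}'_\omega(u).$$
   Context: A non-quasianalytic subadditive weight function is a continuous increasing $\omega:[0,+\infty)\to[0,+\infty)$ with: $(\alpha)$ $\omega(t_1+t_2)\le\omega(t_1)+\omega(t_2)$ for all $t_1,t_2\ge0$; $(\beta)$ $\int_1^{+\infty}\omega(t)t^{-2}dt<+\infty$; $(\gamma)$ $\log t=o(\omega(t))$ as $t\to+\infty$; $(\delta)$ $t\mapsto\omega(e^t)$ is convex. For vectors $\zeta$, $\omega(\zeta):=\omega(|\zeta|)$. Fourier transform: $\hat f(\xi)=\int_{\mathbb{R}^d}e^{-i\langle x,\xi\rangle}f(x)dx$. $\mathcal{S}_\omega(\mathbb{R}^d)$ is the set of Schwartz functions $u$ such that for all $\lambda>0$ and all multi-indices $\alpha$, $\sup_x e^{\lambda\omega(x)}|D^\alpha u(x)|<\infty$ and $\sup_\xi e^{\lambda\omega(\xi)}|D^\alpha\hat u(\xi)|<\infty$, with $D^\alpha=(-i)^{|\alpha|}\partial^\alpha$; it is a Fréchet space with these seminorms, and $\mathcal{S}'_\omega(\mathbb{R}^d)$ is its dual. The bracket $\langle u,\psi\rangle$ for $u\in\mathcal{S}'_\omega$, $\psi\in\mathcal{S}_\omega$ is conjugate linear in $\psi$ and consistent with $\langle f,g\rangle=\int f\bar g$. For $z=(x,\xi)\in\mathbb{R}^{2d}$,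 the phase-space shift is $\Pi(z)=M_\xi T_x$, where $T_xf(y)=f(y-x)$ and $M_\xi f(y)=e^{i\langle y,\xi\rangle}f(y)$; on $\mathcal{S}'_\omega$ these act by duality, $\langle T_yu,\psi\rangle=\langle u,T_{-y}\psi\rangle$ and $\langle M_\eta u,\psi\rangle=\langle u,M_{-\eta}\psi\rangle$. For a window $\varphi\in\mathcal{S}_\omega(\mathbb{R}^d)\setminus\{0\}$ and $f\in\mathcal{S}'_\omega(\mathbb{R}^d)$, the short-time Fourier transform is $V_\varphi f(z)=\langle f,\Pi(z)\varphi\rangle$. $\mathrm{WF}'_\omega(u)$: given a window $\varphi\in\mathcal{S}_\omega(\mathbb{R}^d)\setminus\{0\}$, a point $z_0\in\mathbb{R}^{2d}\setminus\{0\}$ is not in $\mathrm{WF}'_\omega(u)$ if there is an open conic set $\Gamma\subseteq\mathbb{R}^{2d}\setminus\{0\}$ containing $z_0$ with $\sup_{z\in\Gamma}e^{\lambda\omega(z)}|V_\varphi u(z)|<+\infty$ for all $\lambda>0$. (This set does not depend on the choice of $\varphi$.) *)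

(* Defs.v *)
From HB Require Import structures.
From mathcomp Require Import all_boot all_order all_algebra.
From mathcomp Require Import all_classical all_reals all_analysis.
From mathcomp Require Import complex.
Set Implicit Arguments.
Unset Strict Implicit.
Unset Printing Implicit Defensive.
Import Order.TTheory GRing.Theory Num.Theory.
Import numFieldNormedType.Exports.
Local Open Scope classical_set_scope.
Local Open Scope ring_scope.
Local Open Scope complex_scope.

Notation cmod := ComplexField.Normc.normc.

Section Weight.
Context {R : realType}.

(* Only the values of [omega] on [0, +oo[ are constrained, or used. "Increasing"
   is read as nondecreasing, which includes the strict reading. *)
Record nonquasianalytic_subadditive_weight (omega : R -> R) : Prop := {
  weight_ge0 : forall t : R, 0 <= t -> 0 <= omega t;
  weight_continuous : {within `[0, +oo[, continuous omega};
  weight_increasing :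
    forall s t : R, 0 <= s -> s <= t -> omega s <= omega t;
  weight_alpha : forall t1 t2 : R, 0 <= t1 -> 0 <= t2 ->
    omega (t1 + t2) <= omega t1 + omega t2;
  weight_beta :
    (\int[lebesgue_measure]_(t in `[1%R, +oo[) (omega t / t ^+ 2)%:E < +oo)%E;
  weight_gamma : forall eps : R, 0 < eps ->
    \forall t \near +oo%R, `|ln t| <= eps * `|omega t|;
  weight_delta : @convex_function R R^o setT (fun t : R => omega (expR t))
}.

End Weight.

Section Euclidean.
Context {R : realType} {d : nat}.
Implicit Types x y : 'rV[R]_d.

Definition dotp x y : R := \sum_(i < d) x 0 i * y 0 i.

(* The library norm on ['rV_d] is the sup norm. *)
Definition enorm x : R := Num.sqrt (dotp x x).

(* Euclidean norm on R^2d = R^d x R^d *)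
Definition enorm2 (z : 'rV[R]_d * 'rV[R]_d) : R :=
  Num.sqrt (dotp z.1 z.1 + dotp z.2 z.2).

End Euclidean.

Section LebesgueMeasure.
Context {R : realType}.

(* Lebesgue measure on R^n as an iterated product measure: the unit mass at the
   empty tuple for n = 0, then the image of [lebesgue_measure \x lebesgue_tuple n]
   under (x, t) |-> x :: t. *)
Fixpoint lebesgue_tuple (n : nat) : set (n.-tuple R) -> \bar R :=
  match n with
  | 0 => \d_([tuple] : 0.-tuple R)
  | m.+1 => pushforward (lebesgue_measure \x lebesgue_tuple (n := m))%E
              (fun p : R * m.-tuple R => [tuple of p.1 :: p.2])
  end.

Definition cintegral {d : nat} (f : 'rV[R]_d -> R[i]) : R[i] :=
  let F (t : d.-tuple R) := f (\row_i tnth t i) in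
  fine (\int[@lebesgue_tuple d]_t (complex.Re (F t))%:E)%E +i*
  fine (\int[@lebesgue_tuple d]_t (complex.Im (F t))%:E)%E.

End LebesgueMeasure.

Section Functions.
Context {R : realType} {d : nat}.
Implicit Types (f g : 'rV[R]_d -> R[i]) (a b : {ffun 'I_d -> nat}).

Definition cexpi (t : R) : R[i] := cos t +i* sin t.

Definition fourier f : 'rV[R]_d -> R[i] :=
  fun xi => cintegral (fun x => cexpi (- dotp x xi) * f x).

Definition pderiv (i : 'I_d) f : 'rV[R]_d -> R[i] := fun x =>
  'D_(delta_mx 0 i) (fun y => complex.Re (f y)) x +i*
  'D_(delta_mx 0 i) (fun y => complex.Im (f y)) x.

Definition mpderiv a f : 'rV[R]_d -> R[i] :=
  foldr (fun i g => iter (a i) (pderiv i) g) f (enum 'I_d).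

Definition mderiv a f : 'rV[R]_d -> R[i] :=
  fun x => (- 'i) ^+ (\sum_i a i)%N * mpderiv a f x.

(* C^oo: all iterated partial derivatives, in any order, exist and are
   continuous; [pderiv] alone has a junk value where f is not derivable. *)
Definition smooth f : Prop := forall s : seq 'I_d,
  let g := foldr pderiv f s in
  [/\ continuous (fun x => complex.Re (g x)),
      continuous (fun x => complex.Im (g x)) &
      forall i x, derivable (fun y => complex.Re (g y)) x (delta_mx 0 i) /\
                  derivable (fun y => complex.Im (g y)) x (delta_mx 0 i)].

Definition schwartz f : Prop :=
  smooth f /\
  forall a b, (ereal_sup [set
    (`|\prod_i x 0 i ^+ b i| * cmod (mderiv a f x))%:E | x in [set: 'rV[R]_d]] < +oo)%E.

Definition translation (x : 'rV[R]_d) f : 'rV[R]_d -> R[i] :=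
  fun y => f (y - x).

Definition modulation (xi : 'rV[R]_d) f : 'rV[R]_d -> R[i] :=
  fun y => cexpi (dotp y xi) * f y.

Definition phase_shift (z : 'rV[R]_d * 'rV[R]_d) f : 'rV[R]_d -> R[i] :=
  modulation z.2 (translation z.1 f).

End Functions.

Section Somega.
Context {R : realType} {d : nat}.
Variable omega : R -> R.
Implicit Types (f g : 'rV[R]_d -> R[i]) (a : {ffun 'I_d -> nat}).
Implicit Types (u : ('rV[R]_d -> R[i]) -> R[i]) (z : 'rV[R]_d * 'rV[R]_d).

Definition wseminorm (lambda : R) a f : \bar R :=
  ereal_sup [set (expR (lambda * omega (enorm x)) * cmod (mderiv a f x))%:E
            | x in [set: 'rV[R]_d]].

Definition Somega f : Prop :=
  schwartz f /\
  forall lambda a, 0 < lambda ->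
    (wseminorm lambda a f < +oo)%E /\ (wseminorm lambda a (fourier f) < +oo)%E.

(* Elements of the dual are represented by total maps u, with
   u psi = <u, psi>; only the restriction of u to [Somega] is meaningful. *)
Definition conj_linear u : Prop :=
  forall (c : R[i]) f g, Somega f -> Somega g ->
    u (fun x => c * f x + g x) = c^* * u f + u g.

(* Continuity for the locally convex topology defined by the seminorms
   f |-> wseminorm lambda a f and f |-> wseminorm lambda a (fourier f): a basic
   neighbourhood of f is given by finitely many (lambda, a) and a radius. *)
Definition Somega_continuous u : Prop :=
  forall f, Somega f -> forall e : R, 0 < e ->
  exists (J : seq (R * {ffun 'I_d -> nat})) (delta : R),
    [/\ 0 < delta, (forall j, j \in J -> 0 < j.1) &
    forall g, Somega g ->
      let h x := g x - f x in
      (forall j, j \in J ->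
        (wseminorm j.1 j.2 h < delta%:E)%E /\
        (wseminorm j.1 j.2 (fourier h) < delta%:E)%E) ->
      cmod (u g - u f) < e].

Definition Somega_dual u : Prop := conj_linear u /\ Somega_continuous u.

Definition translation_dual (y : 'rV[R]_d) u : ('rV[R]_d -> R[i]) -> R[i] :=
  fun psi => u (translation (- y) psi).

Definition modulation_dual (eta : 'rV[R]_d) u : ('rV[R]_d -> R[i]) -> R[i] :=
  fun psi => u (modulation (- eta) psi).

Definition phase_shift_dual z u : ('rV[R]_d -> R[i]) -> R[i] :=
  modulation_dual z.2 (translation_dual z.1 u).

Definition window f : Prop := Somega f /\ exists x, f x != 0.

Definition stft (phi : 'rV[R]_d -> R[i]) u z : R[i] := u (phase_shift z phi).

Definition conic (G : set ('rV[R]_d * 'rV[R]_d)) : Prop :=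
  forall z (t : R), 0 < t -> G z -> G (t *: z).

(* The wave front set computed with the window phi. *)
Definition WF' (phi : 'rV[R]_d -> R[i]) u : set ('rV[R]_d * 'rV[R]_d) :=
  [set z0 | z0 != 0 /\
    ~ exists G : set ('rV[R]_d * 'rV[R]_d),
      [/\ open G, conic G, ~ G 0, G z0 &
          forall lambda : R, 0 < lambda ->
            (ereal_sup [set (expR (lambda * omega (enorm2 z)) *
                             cmod (stft phi u z))%:E | z in G] < +oo)%E]].

End Somega.

(* Main.v *)
(** If [f] is smooth and rapidly decreasing then so is [x_j f], and Taylor estimates
    for sine and cosine under the integral give [d_j f^ = (- i x_j f)^]; hence [f^] is
    smooth.  Together with [(M_xi T_t f)^ = T_xi M_(-t) f^] and the Leibniz rule this
    bounds the seminorms of [M_xi T_t phi] locally uniformly in [(t, xi)].  Therefore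
    [S_omega] is invariant under phase-space shifts and, by continuity of [u], the
    transform [V_phi u] is locally bounded.

    Now [|V_phi (Pi(w) u) (z)| = |V_phi u (z - w)|].  If [V_phi u] decays on an open cone
    around [z0], shrink the cone: far from the origin its translate by [- w] lies in the
    original cone, where subadditivity of [omega] absorbs the shift, and the rest of it is
    bounded, where local boundedness suffices. *)

(* The obstacle lies in the test space: bounds are imposed on f^ as well as on f, and [pderiv] has a
   default value where a derivative fails to exist. Leibniz's rule can therefore be applied to
   M_(-t) f^ only after f^ is known to be smooth. Differentiation under the integral is reduced to
   one inequality: the remainder estimate |k(a+h) - k(a) - h k'(a)| <= h^2, for k cosine or sine, is
   used with increment h x_j and integrated, which leaves an error quadratic in h.

   Leibniz's rule is kept unexpanded. M_xi conjugates d_i into d_i + i xi_i, and a product of such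
   operators is bounded one factor at a time; each choice keeps or deletes a derivative, so only
   subwords of the original word occur, and these are again multi-indices.

   Both sides of the theorem use the same window, and the unshifted transform is the shifted one
   translated back, so one transfer lemma gives both inclusions. Continuity of u enters at the zero
   function with tolerance 1; scaling turns it into a bound uniform over a ball of shifts. *)
Require Import Defs.
From HB Require Import structures.
From mathcomp Require Import all_boot all_order all_algebra.
From mathcomp Require Import all_classical all_reals all_analysis.
From mathcomp Require Import measurable_realfun complex ring lra.
Set Implicit Arguments.
Unset Strict Implicit.
Unset Printing Implicit Defensive.
Import Order.TTheory GRing.Theory Num.Theory.
Import numFieldNormedType.Exports.
Local Open Scope classical_set_scope.
Local Open Scope ring_scope.
Local Open Scope complex_scope.

(** * Lebesgue measure on tuples *)

Section TupleMeasure.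
Context {R : realType}.
Implicit Type n : nat.

Definition tuple_cons n (p : R * n.-tuple R) : n.+1.-tuple R := [tuple of p.1 :: p.2].

Lemma measurable_tuple_cons n : measurable_fun setT (@tuple_cons n).
Proof. exact: measurable_cons. Qed.

Definition tuple_uncons n (t : n.+1.-tuple R) : R * n.-tuple R :=
  (thead t, [tuple of behead t]).

Lemma tuple_consK n : cancel (@tuple_cons n) (@tuple_uncons n).
Proof.
move=> [x t]; rewrite /tuple_uncons/= theadE; congr pair.
by apply/val_inj.
Qed.

Lemma measurable_tuple_uncons n : measurable_fun setT (@tuple_uncons n).
Proof.
apply: measurable_fun_pair; last exact: measurable_behead.
exact: measurable_tnth.
Qed.

(** The product in dimension n + 1 is known to be a measure once the n-dimensional factor is a
    sigma-finite measure. One existential carries both properties through the induction, and the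
    canonical instances are read off from it. *)
Lemma sigma_finite_lebesgue_tuple n :
  exists m : {sigma_finite_measure set (n.-tuple R) -> \bar R},
    m = @lebesgue_tuple R n :> (set (n.-tuple R) -> \bar R).
Proof.
elim: n => [|n [m mE]].
  by exists (\d_([tuple] : 0.-tuple R))%R.
have mc : measurable_fun [set: measurableTypeR R * n.-tuple R]
    (@tuple_cons n : _ -> n.+1.-tuple R) by exact: measurable_tuple_cons.
pose p : {measure set (n.+1.-tuple R) -> \bar R} :=
  measure_function_pushforward__canonical__measure_function_Measure
    (lebesgue_measure \x m)%E mc.
have pE : p = @lebesgue_tuple R n.+1 :> (set (n.+1.-tuple R) -> \bar R).
  by rewrite /p /= mE.
have psf : sigma_finite setT p.
  have /sigma_finiteP[F [TF ndF Foo]] := sigma_finiteT (@lebesgue_measure R).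
  have /sigma_finiteP[G [TG ndG Goo]] := sigma_finiteT m.
  exists (fun i => @tuple_uncons n @^-1` (F i `*` G i)).
    rewrite -preimage_bigcup; apply/esym/seteqP; split => // t _ /=.
    have : [set: measurableTypeR R] (tuple_uncons t).1 by [].
    rewrite TF => -[k _ Fk].
    have : [set: n.-tuple R] (tuple_uncons t).2 by [].
    rewrite TG => -[l _ Gl].
    (* Both exhaustions increase, so the larger index captures both components. *)
    exists (maxn k l) => //; split.
      exact: (subsetPset _ _ (ndF _ _ (leq_maxl k l))).
    exact: (subsetPset _ _ (ndG _ _ (leq_maxr k l))).
  move=> i; have [mF Fi] := Foo i; have [mG Gi] := Goo i; split.
    rewrite -[X in measurable X]setTI; apply: measurable_tuple_uncons => //.
    exact: measurableX.
  rewrite /p /= /pushforward -comp_preimage.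
  rewrite (_ : _ \o _ = id); last by apply/funext => x; exact: tuple_consK.
  rewrite preimage_id product_measure1E//.
  by rewrite lte_mul_pinfty// ge0_fin_numE.
pose mix := @Measure_isSigmaFinite.Build _ _ _ p psf.
pose p' : {sigma_finite_measure set (n.+1.-tuple R) -> \bar R} :=
  HB.pack (Measure.sort p) mix.
by exists p'.
Qed.

Let lebesgue_tuple0 n : @lebesgue_tuple R n set0 = 0%E.
Proof. by have [m <-] := sigma_finite_lebesgue_tuple n; exact: measure0. Qed.

Let lebesgue_tuple_ge0 n A : (0 <= @lebesgue_tuple R n A)%E.
Proof. by have [m <-] := sigma_finite_lebesgue_tuple n; exact: measure_ge0. Qed.

Let lebesgue_tuple_sigma_additive n : semi_sigma_additive (@lebesgue_tuple R n).
Proof.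
have [m <-] := sigma_finite_lebesgue_tuple n.
exact: measure_semi_sigma_additive.
Qed.

HB.instance Definition _ n := isMeasure.Build _ _ _ (@lebesgue_tuple R n)
  (@lebesgue_tuple0 n) (@lebesgue_tuple_ge0 n) (@lebesgue_tuple_sigma_additive n).

Let lebesgue_tuple_sigma_finite n : sigma_finite setT (@lebesgue_tuple R n).
Proof.
by have [m <-] := sigma_finite_lebesgue_tuple n; exact: sigma_finiteT.
Qed.

HB.instance Definition _ n := Measure_isSigmaFinite.Build _ _ _
  (@lebesgue_tuple R n) (@lebesgue_tuple_sigma_finite n).

Lemma ge0_integral_lebesgue_tupleS n (f : n.+1.-tuple R -> \bar R) :
  measurable_fun [set: n.+1.-tuple R] f -> (forall t, 0 <= f t)%E ->
  (\int[@lebesgue_tuple R n.+1]_t f t =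
   \int[lebesgue_measure]_x \int[@lebesgue_tuple R n]_t f [tuple of x :: t])%E.
Proof.
move=> mf f0.
have mc : measurable_fun [set: measurableTypeR R * n.-tuple R]
    (@tuple_cons n : _ -> n.+1.-tuple R) by exact: measurable_tuple_cons.
rewrite (ge0_integral_pushforward mc (lebesgue_measure \x @lebesgue_tuple R n)%E)//.
rewrite preimage_setT (@fubini_tonelli1 _ _ (measurableTypeR R) _ R lebesgue_measure
  (@lebesgue_tuple R n) (f \o @tuple_cons n))//.
- exact: (measurableT_comp mf mc).
- by move=> p /=.
Qed.

(** The image of Lebesgue measure under the shift gives every half-open interval its length, and
    this determines the measure. *)
Lemma ge0_integral_shift (f : R -> \bar R) a :
  measurable_fun [set: R] f -> (forall x, 0 <= f x)%E ->
  (\int[lebesgue_measure]_x f (x + a)%R = \int[lebesgue_measure]_x f x)%E.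
Proof.
move=> mf f0.
pose sh : measurableTypeR R -> measurableTypeR R := fun x => x + a.
have ms : measurable_fun setT sh by exact: measurable_funD.
transitivity (\int[pushforward lebesgue_measure sh]_x f x)%E.
  by rewrite ge0_integral_pushforward// preimage_setT.
apply: eq_measure_integral => A mA _ /=.
pose p : {measure set (measurableTypeR R) -> \bar R} :=
  measure_function_pushforward__canonical__measure_function_Measure
    (@lebesgue_measure R) ms.
apply/esym/(@lebesgue_measure_unique _ p) => // _ [[u v] /= uv <-].
rewrite /pushforward (_ : _ @^-1` _ = `]u - a, v - a]%classic).
  by rewrite !lebesgue_measure_itv/= !lte_fin ltrD2r -!EFinD opprD addrACA subrr addr0.
by apply/seteqP; split => x /=; rewrite !in_itv/= ltrBlDr lerBrDr.
Qed.

Definition tuple_shift n (a : 'I_n -> R) (t : n.-tuple R) : n.-tuple R :=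
  [tuple tnth t i + a i | i < n].

Lemma measurable_tuple_shift n (a : 'I_n -> R) :
  measurable_fun [set: n.-tuple R] (tuple_shift a).
Proof.
apply/measurable_fun_tnthP => i.
rewrite (_ : _ \o _ = fun t : n.-tuple R => tnth t i + a i).
  by apply: measurable_funD => //; exact: measurable_tnth.
by apply/funext => t /=; rewrite tnth_mktuple.
Qed.

(** By Tonelli, the induction hypothesis shifts the inner variables and one-dimensional invariance
    shifts the outer one. *)
Lemma ge0_integral_tuple_shift n (a : 'I_n -> R) (f : n.-tuple R -> \bar R) :
  measurable_fun [set: n.-tuple R] f -> (forall t, 0 <= f t)%E ->
  (\int[@lebesgue_tuple R n]_t f (tuple_shift a t) =
   \int[@lebesgue_tuple R n]_t f t)%E.
Proof.
elim: n a f => [a f mf f0|n IHn a f mf f0].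
  by apply: eq_integral => t _; rewrite (tuple0 t) (tuple0 (tuple_shift a _)).
have msh := measurable_tuple_shift a.
have mc x : measurable_fun [set: n.-tuple R] (fun t : n.-tuple R => [tuple of x :: t] : n.+1.-tuple R).
  by apply: measurable_cons => //; exact: measurable_id.
rewrite ge0_integral_lebesgue_tupleS//; last exact: measurableT_comp.
rewrite [RHS]ge0_integral_lebesgue_tupleS//.
pose F x := (\int[@lebesgue_tuple R n]_t f [tuple of x :: t])%E.
rewrite -(@ge0_integral_shift F (a ord0)); last 2 first.
- apply: (@measurable_fun_fubini_tonelli_F _ _ (measurableTypeR R) _ R
    (@lebesgue_tuple R n) (fun p => f (tuple_cons p))).
  + by apply: measurableT_comp => //; exact: measurable_tuple_cons.
  + by move=> p.
- by move=> x; exact: integral_ge0.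
apply: eq_integral => x _; rewrite /F.
rewrite -(IHn (fun i => a (lift ord0 i)) (fun t => f [tuple of (x + a ord0)%R :: t]))//; last first.
  exact: measurableT_comp.
apply: eq_integral => t _; congr f; apply: eq_from_tnth => i.
rewrite tnth_mktuple; case: (unliftP ord0 i) => [j|] ->; last by rewrite !tnth0.
by rewrite !tnthS tnth_mktuple.
Qed.

Lemma integral_tuple_shift n (a : 'I_n -> R) (f : n.-tuple R -> \bar R) :
  measurable_fun [set: n.-tuple R] f ->
  (\int[@lebesgue_tuple R n]_t f (tuple_shift a t) =
   \int[@lebesgue_tuple R n]_t f t)%E.
Proof.
move=> mf; rewrite integralE [RHS]integralE; congr (_ - _)%E.
  rewrite -[RHS](ge0_integral_tuple_shift a (measurable_funepos mf) (funepos_ge0 _)).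
  by apply: eq_integral => t _; rewrite -[LHS]/((f \o tuple_shift a)^\+ t)%E funepos_comp.
rewrite -[RHS](ge0_integral_tuple_shift a (measurable_funeneg mf) (funeneg_ge0 _)).
by apply: eq_integral => t _; rewrite -[LHS]/((f \o tuple_shift a)^\- t)%E funeneg_comp.
Qed.

End TupleMeasure.

(** * Measurability of continuous functions on tuples *)

Section RapidDecay.
Context {R : realType} {d : nat}.
Implicit Types (p q : 'rV[R]_d -> R) (x : 'rV[R]_d).

Notation rowt t := (\row_i tnth t i).

(** Continuity refers to the topology of row vectors, measurability to the sigma-algebra generated
    by the coordinates. They meet because an open set is a countable union of boxes with rational
    centres. *)
Lemma measurable_continuous_row p : continuous p ->
  measurable_fun [set: d.-tuple R] (fun t => p (rowt t)).
Proof.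
move=> /continuousP cp; apply: (measurability _ (RGenOpens.measurableE R)).
move=> _ [_ [a [b ->] <-]]; rewrite setTI.
pose U := p @^-1` `]a, b[%classic.
have oU : open U by apply: cp; exact: interval_open.
(* The box with centre [u.1] and half-width 1/(k+1), k = [u.2], replaced by the empty set unless it
   lies in [U]. *)
pose F (u : 'rV[rat]_d * nat) : set (d.-tuple R) :=
  if `[< ball (map_mx ratr u.1 : 'rV[R]_d) u.2.+1%:R^-1 `<=` U >]
  then \bigcap_(i in [set: 'I_d])
    [set t | `|ratr (u.1 0 i) - tnth t i| < u.2.+1%:R^-1] else set0.
have -> : (fun t => p (rowt t)) @^-1` `]a, b[%classic = \bigcup_u F u.
  apply/seteqP; split=> [t /= tab|t [u _]].
    have /open_nbhs_nbhs /nbhs_ballP[e /= e0 eU] : open_nbhs (rowt t) U.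
      by split.
    (* With half-width below e/2, a box that contains [t] stays within distance e of [t]. *)
    have [k ke] : exists k, k.+1%:R^-1 < e / 2.
      exists (Num.truncn (e / 2)^-1); rewrite invf_plt ?posrE// ?divr_gt0//.
      exact: truncnS_gt.
    have hq i : exists q : rat, `|ratr q - tnth t i| < k.+1%:R^-1.
      have [] := @rat_in_itvoo R (tnth t i - k.+1%:R^-1) (tnth t i + k.+1%:R^-1).
        by rewrite ltrBlDr -addrA ltrDl addr_gt0// invr_gt0.
      move=> q; rewrite in_itv/= => hq; exists q.
      by rewrite distrC ltr_distlC.
    pose q := \row_i (projT1 (cid (hq i))).
    have qt i : `|ratr (q 0 i) - tnth t i| < k.+1%:R^-1.
      by rewrite mxE; case: cid.
    exists (q, k) => //; rewrite /F/= asboolT => [i _ /=|]; first exact: qt.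
    move=> z [_ /= qz]; apply: eU; split => // i j; rewrite /ball/= mxE.
    rewrite ord1; have := qz 0 j; rewrite /ball/= mxE => qzj.
    rewrite -(subrKA (ratr (q 0 j))) (le_lt_trans (ler_normD _ _))//.
    rewrite (splitr e) ltrD//; last exact: lt_trans ke.
    by rewrite distrC (lt_trans (qt j)).
  rewrite /F; case: ifPn => // /asboolP qU qt; apply: (qU (rowt t)).
  split; first by rewrite invr_gt0.
  by move=> i j; rewrite ord1 /ball/= !mxE; exact: qt.
apply: countable_bigcupT_measurable; first exact: countableP.
move=> u; rewrite /F; case: ifPn => // _.
apply: fin_bigcap_measurable => // i _.
rewrite (_ : [set _ | _] = (fun t => tnth t i) @^-1`
    (ball (ratr (u.1 0 i) : R) u.2.+1%:R^-1)); last by [].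
rewrite -[X in measurable X]setTI; apply: measurable_tnth => //.
exact: measurable_ball.
Qed.

End RapidDecay.

(** * Integrability against a polynomial weight *)

Section ProductWeight.
Context {R : realType}.

Lemma oneDsqr_gt0 (a : R) : 0 < oneDsqr a.
Proof. exact: lt_le_trans (oneDsqr_ge1 a). Qed.

Lemma oneDsqr_ge0 (a : R) : 0 <= oneDsqr a.
Proof. exact/ltW/oneDsqr_gt0. Qed.

Lemma integral_oneDsqrV_lty :
  (\int[lebesgue_measure]_x ((oneDsqr x)^-1 : R)%:E < +oo)%E.
Proof.
rewrite (@ge0_symfun_integralT R (fun x => (oneDsqr x)^-1)).
- rewrite (_ : [set x | _] = `[0%R, +oo[%classic).
    by rewrite integral0y_oneDsqr -EFinM ltry.
  by apply/seteqP; split => x /=; rewrite in_itv/= andbT.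
- by move=> x; rewrite invr_ge0 oneDsqr_ge0.
- exact: continuous_oneDsqrV.
- by move=> x /=; rewrite /oneDsqr sqrrN.
Qed.


Lemma measurable_prod_oneDsqrV n : measurable_fun [set: n.-tuple R]
  (fun t => (\prod_i (oneDsqr (tnth t i))^-1)%:E).
Proof.
have mg : measurable_fun [set: R] (fun a : R => (oneDsqr a)^-1).
  by apply: continuous_measurable_fun; exact: continuous_oneDsqrV.
apply/measurable_EFinP; apply: measurable_prod => i _.
exact: (measurableT_comp mg (measurable_tnth i)).
Qed.

Lemma integral_prod_oneDsqrV_lty n :
  (\int[@lebesgue_tuple R n]_t (\prod_i (oneDsqr (tnth t i))^-1)%:E < +oo)%E.
Proof.
have prod_ge0 m (t : m.-tuple R) : 0 <= \prod_i (oneDsqr (tnth t i))^-1.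
  by apply: prodr_ge0 => i _; rewrite invr_ge0 oneDsqr_ge0.
elim: n => [|n IHn].
  rewrite (eq_integral (cst 1%E)) => [|t _]; last by rewrite big_ord0.
  by rewrite integral_cst// mul1e /= diracE ltry.
rewrite ge0_integral_lebesgue_tupleS; last 2 first.
- exact: measurable_prod_oneDsqrV.
- by move=> t; rewrite lee_fin.
set I := (\int[_]_t _)%E in IHn.
rewrite (@eq_integral _ (measurableTypeR R) R lebesgue_measure setT
  (fun x : R => ((oneDsqr x)^-1)%:E * I)%E); last first.
  move=> x _; rewrite /I -ge0_integralZl_EFin//.
  - apply: eq_integral => t _; rewrite big_ord_recl tnth0 EFinM.
    congr (_ * _%:E)%E; apply: eq_bigr => i _.
    by rewrite tnthS.
  - by move=> t _; rewrite lee_fin.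
  - exact: measurable_prod_oneDsqrV.
have I0 : (0 <= I)%E by apply: integral_ge0 => t _; rewrite lee_fin.
rewrite ge0_integralZr//.
- apply: lte_mul_pinfty => //.
    by apply: integral_ge0 => x _; rewrite lee_fin invr_ge0 oneDsqr_ge0.
  rewrite ge0_fin_numE ?integral_oneDsqrV_lty//.
  by apply: integral_ge0 => x _; rewrite lee_fin invr_ge0 oneDsqr_ge0.
- apply/measurable_EFinP.
  by apply: continuous_measurable_fun; exact: continuous_oneDsqrV.
Qed.

Context {d : nat}.
Implicit Types (p q : 'rV[R]_d -> R) (x : 'rV[R]_d).
Notation rowt t := (\row_i tnth t i).

(** The integrable majorant is C times the product of the 1/(1 + x_i^2). *)
Lemma integrable_row p C : continuous p ->
  (forall x, \prod_i oneDsqr (x 0 i) * `|p x| <= C) ->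
  (@lebesgue_tuple R d).-integrable setT (fun t => (p (rowt t))%:E).
Proof.
move=> cp pC.
apply: (@le_integrable _ _ _ _ _ measurableT _
  (fun t => (C * \prod_i (oneDsqr (tnth t i))^-1)%:E)).
- by apply/measurable_EFinP; exact: measurable_continuous_row.
- move=> t _ /=; rewrite lee_fin (le_trans _ (ler_norm _))//.
  rewrite prodfV ler_pdivlMr; last first.
    by apply: prodr_gt0 => i _; exact: oneDsqr_gt0.
  rewrite mulrC; have := pC (rowt t).
  by under eq_bigr do rewrite mxE.
- under eq_fun do rewrite EFinM.
  apply: integrableZl => //; apply/integrableP; split.
    exact: measurable_prod_oneDsqrV.
  under eq_integral => t _.
    rewrite gee0_abs; last first.
      by rewrite lee_fin; apply: prodr_ge0 => i _; rewrite invr_ge0 oneDsqr_ge0.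
    over.
  exact: integral_prod_oneDsqrV_lty.
Qed.
End ProductWeight.

(** * Partial derivatives, translations and modulations *)

Section Derivatives.
Context {R : realType} {d : nat}.
Implicit Types (f g : 'rV[R]_d -> R[i]) (x xi t : 'rV[R]_d) (i : 'I_d).
Implicit Types (c : R[i]) (s : seq 'I_d).

Local Notation e_ i := (delta_mx 0 i : 'rV[R]_d).
Local Notation RE f := (fun x => complex.Re (f x)).
Local Notation IM f := (fun x => complex.Im (f x)).

(** A relation that carries existence and value together, because the value of [pderiv] alone does
    not show that a derivative exists. *)
Definition has_pderiv i f x (df : R[i]) :=
  is_derive x (e_ i) (RE f) (complex.Re df) /\ is_derive x (e_ i) (IM f) (complex.Im df).

Lemma has_pderiv_val i f x df : has_pderiv i f x df -> pderiv i f x = df.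
Proof.
by move=> [h1 h2]; rewrite /pderiv !derive_val; case: df {h1 h2}.
Qed.

Definition partially_derivable i f x :=
  derivable (RE f) x (e_ i) /\ derivable (IM f) x (e_ i).

Lemma partially_derivableP i f x :
  partially_derivable i f x <-> has_pderiv i f x (pderiv i f x).
Proof.
split=> [[h1 h2]|[h1 h2]]; last by split.
by split; apply: derivableP.
Qed.

Lemma Re_lin c z w : complex.Re (c * z + w) =
  complex.Re c * complex.Re z - complex.Im c * complex.Im z + complex.Re w.
Proof. by case: c z w => [? ?] [? ?] [? ?]. Qed.

Lemma Im_lin c z w : complex.Im (c * z + w) =
  complex.Re c * complex.Im z + complex.Im c * complex.Re z + complex.Im w.
Proof. by case: c z w => [? ?] [? ?] [? ?]. Qed.

Lemma has_pderiv_lin i c f g x df dg :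
  has_pderiv i f x df -> has_pderiv i g x dg ->
  has_pderiv i (fun y => c * f y + g y) x (c * df + dg).
Proof.
move=> [f1 f2] [g1 g2]; split.
  rewrite (_ : (fun _ => _) =
    complex.Re c \*: RE f - complex.Im c \*: IM f + RE g); last first.
    by apply/funext => y; rewrite Re_lin.
  by apply: is_derive_eq; rewrite Re_lin.
rewrite (_ : (fun _ => _) =
  complex.Re c \*: IM f + complex.Im c \*: RE f + IM g); last first.
  by apply/funext => y; rewrite Im_lin.
by apply: is_derive_eq; rewrite Im_lin.
Qed.

Lemma dotpDl x y t : dotp (x + y) t = dotp x t + dotp y t.
Proof. by rewrite /dotp -big_split/=; apply: eq_bigr => i _; rewrite mxE mulrDl. Qed.

Lemma dotpZl (a : R) x t : dotp (a *: x) t = a * dotp x t.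
Proof. by rewrite /dotp mulr_sumr; apply: eq_bigr => i _; rewrite mxE mulrA. Qed.

Lemma dotpC x t : dotp x t = dotp t x.
Proof. by apply: eq_bigr => i _; rewrite mulrC. Qed.

Lemma dotpNl x t : dotp (- x) t = - dotp x t.
Proof. by rewrite -scaleN1r dotpZl mulN1r. Qed.

Lemma dotpBl x y t : dotp (x - y) t = dotp x t - dotp y t.
Proof. by rewrite dotpDl dotpNl. Qed.

Lemma dotpN x t : dotp x (- t) = - dotp x t.
Proof. by rewrite dotpC dotpNl dotpC. Qed.

Lemma dotp_delta i x : dotp (e_ i) x = x 0 i.
Proof.
rewrite /dotp (bigD1 i)//= mxE !eqxx mul1r big1 ?addr0// => j ji.
by rewrite mxE eqxx (negbTE ji) mul0r.
Qed.

(** Moving along e_i changes the dot product at speed xi_i, so the difference quotient is literally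
    that of [h] in the direction xi_i; linearity of the differential then extracts this factor. *)
Lemma is_derive_dotp (h : R -> R) dh x xi i :
  is_derive (dotp x xi) 1 h dh ->
  is_derive x (e_ i) (fun y => h (dotp y xi)) (dh * xi 0 i).
Proof.
move=> hd; set a := dotp x xi in hd *.
have dif : differentiable h a by exact/derivable1_diffP.
have E : (fun k : R => k^-1 *: (((fun y => h (dotp y xi)) \o shift x) (k *: e_ i)
    - h (dotp x xi))) =
  (fun k : R => k^-1 *: ((h \o shift a) (k *: xi 0 i) - h a)).
  by apply/funext => k /=; rewrite dotpDl dotpZl dotp_delta.
apply: DeriveDef; first by rewrite /derivable E; exact: (diff_derivable dif).
rewrite /derive E -/(derive h a (xi 0 i)) deriveE//.
have -> : xi 0 i = xi 0 i *: (1 : R) by rewrite /GRing.scale/= mulr1.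
rewrite linearZ/= -deriveE// derive_val /GRing.scale/= mulr1.
exact: mulrC.
Qed.

Lemma Re_cexpiM (a : R) z :
  complex.Re (cexpi a * z) = cos a * complex.Re z - sin a * complex.Im z.
Proof. by case: z. Qed.

Lemma Im_cexpiM (a : R) z :
  complex.Im (cexpi a * z) = cos a * complex.Im z + sin a * complex.Re z.
Proof. by case: z. Qed.

(** The phase is factored out so that the derivative is again a modulation, which allows
    iteration. *)
Lemma has_pderiv_modulation i xi f x df : has_pderiv i f x df ->
  has_pderiv i (modulation xi f) x
    (cexpi (dotp x xi) * ((0 +i* xi 0 i) * f x + df)).
Proof.
move=> [f1 f2].
have dc : is_derive x (e_ i) (fun y => cos (dotp y xi)) (- sin (dotp x xi) * xi 0 i).
  exact: is_derive_dotp.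
have ds : is_derive x (e_ i) (fun y => sin (dotp y xi)) (cos (dotp x xi) * xi 0 i).
  exact: is_derive_dotp.
split.
  rewrite (_ : (fun _ => _) = (fun y => cos (dotp y xi)) * RE f
      - (fun y => sin (dotp y xi)) * IM f); last first.
    by apply/funext => y; rewrite /modulation Re_cexpiM.
  apply: is_derive_eq; rewrite /GRing.scale/=; case: (f x) df {f1 f2} => u v [p q] /=.
  ring.
rewrite (_ : (fun _ => _) = (fun y => cos (dotp y xi)) * IM f
    + (fun y => sin (dotp y xi)) * RE f); last first.
  by apply/funext => y; rewrite /modulation Im_cexpiM.
apply: is_derive_eq; rewrite /GRing.scale/=; case: (f x) df {f1 f2} => u v [p q] /=.
ring.
Qed.

(** The two difference quotients are the same function, so the default values agree as well. *)
Lemma pderiv_translation i t f :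
  pderiv i (translation t f) = translation t (pderiv i f).
Proof.
have E (F : 'rV[R]_d -> R) x : 'D_(e_ i) (fun y => F (y - t)) x = 'D_(e_ i) F (x - t).
  rewrite /derive; set g := (X in lim (X @ _)); set h := (X in _ = lim (X @ _)).
  by have -> : g = h by apply/funext => k; rewrite /g /h /= addrA.
by apply/funext => x; rewrite /pderiv /translation (E (RE f)) (E (IM f)).
Qed.

Definition iter_pderiv s f := foldr pderiv f s.

Lemma smooth_pderivable f s i x : smooth f ->
  has_pderiv i (iter_pderiv s f) x (pderiv i (iter_pderiv s f) x).
Proof. by move=> /(_ s)[_ _ h]; apply/partially_derivableP; exact: h. Qed.

Lemma iter_pderiv_lin c f g s : smooth f -> smooth g ->
  iter_pderiv s (fun x => c * f x + g x) =
  (fun x => c * iter_pderiv s f x + iter_pderiv s g x).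
Proof.
move=> sf sg; elim: s => //= i s ->; apply/funext => x.
by apply/has_pderiv_val/has_pderiv_lin; exact: smooth_pderivable.
Qed.

Lemma iter_pderiv_translation t f s :
  iter_pderiv s (translation t f) = translation t (iter_pderiv s f).
Proof. by elim: s => //= i s ->; rewrite pderiv_translation. Qed.

Definition ccontinuous f := continuous (RE f) /\ continuous (IM f).

Lemma continuous_comb (u v p q : 'rV[R]_d -> R) :
  continuous u -> continuous v -> continuous p -> continuous q ->
  continuous (fun x => u x * p x + v x * q x).
Proof.
move=> cu cv cp cq x.
exact: (continuousD (continuousM (cu x) (cp x)) (continuousM (cv x) (cq x))).
Qed.

Lemma ccontinuous_comb f g h1 h2 : ccontinuous f -> ccontinuous g ->
  ccontinuous h1 -> ccontinuous h2 -> ccontinuous (fun x => f x * h1 x + g x * h2 x).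
Proof.
have E z1 w1 z2 w2 : z1 * w1 + z2 * w2 =
    ((complex.Re z1 * complex.Re w1 + - complex.Im z1 * complex.Im w1) +
     (complex.Re z2 * complex.Re w2 + - complex.Im z2 * complex.Im w2)) +i*
    ((complex.Re z1 * complex.Im w1 + complex.Im z1 * complex.Re w1) +
     (complex.Re z2 * complex.Im w2 + complex.Im z2 * complex.Re w2)) :> R[i].
  by case: z1 w1 z2 w2 => [? ?] [? ?] [? ?] [? ?]; congr (_ +i* _) => /=; ring.
move=> [f1 f2] [g1 g2] [a1 a2] [b1 b2].
have cN (p : 'rV[R]_d -> R) : continuous p -> continuous (fun x => - p x).
  move=> cp x; exact (@continuousN _ _ _ p x (cp x)).
have cD (p q : 'rV[R]_d -> R) : continuous p -> continuous q ->
    continuous (fun x => p x + q x).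
  by move=> cp cq x; exact: continuousD (cp x) (cq x).
split; under eq_fun do rewrite E /=; apply: cD; apply: continuous_comb => //;
  exact: cN.
Qed.

Lemma ccontinuous_cst c : ccontinuous (fun=> c).
Proof. by split; exact: cst_continuous. Qed.

Lemma ccontinuous_lin c f g : ccontinuous f -> ccontinuous g ->
  ccontinuous (fun x => c * f x + g x).
Proof.
move=> cf cg; rewrite (_ : (fun _ => _) = fun x => c * f x + 1 * g x); last first.
  by apply/funext => x; rewrite mul1r.
by apply: ccontinuous_comb => //; exact: ccontinuous_cst.
Qed.

Lemma continuous_dotp xi : continuous (fun x => dotp x xi).
Proof.
rewrite /dotp; elim: (index_enum _) => [|i r IHr].
  by under eq_fun do rewrite big_nil; exact: cst_continuous.
under eq_fun do rewrite big_cons.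
move=> x; apply: (continuousD _ (IHr x)).
exact: (continuousM (@coord_continuous _ _ _ _ _ x) (@cst_continuous _ _ _ x)).
Qed.

Lemma ccontinuous_modulation xi f : ccontinuous f -> ccontinuous (modulation xi f).
Proof.
move=> cf; rewrite (_ : modulation xi f =
    fun x => cexpi (dotp x xi) * f x + 0 * f x); last first.
  by apply/funext => x; rewrite mul0r addr0.
apply: ccontinuous_comb => //; last exact: ccontinuous_cst.
split=> x /=; apply: (continuous_comp (@continuous_dotp xi x)).
  exact: continuous_cos.
exact: continuous_sin.
Qed.

Lemma smoothP f : smooth f <->
  forall s, ccontinuous (iter_pderiv s f) /\
    forall i x, partially_derivable i (iter_pderiv s f) x.
Proof. by split=> h s; have := h s; [move=> [? ? ?]|move=> [[? ?] ?]]; split. Qed.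

Lemma smooth_lin c f g : smooth f -> smooth g -> smooth (fun x => c * f x + g x).
Proof.
move=> sf sg; apply/smoothP => s; rewrite iter_pderiv_lin//.
move: (sf) (sg) => /smoothP/(_ s)[cf df] /smoothP/(_ s)[cg dg].
split; first exact: ccontinuous_lin.
move=> i x; suff [] : has_pderiv i (fun y => c * iter_pderiv s f y + iter_pderiv s g y) x
  (c * pderiv i (iter_pderiv s f) x + pderiv i (iter_pderiv s g) x) by split.
by apply: has_pderiv_lin; exact: smooth_pderivable.
Qed.

Lemma smooth_iter_pderiv s f : smooth f -> smooth (iter_pderiv s f).
Proof. by move=> sf s'; rewrite /= /iter_pderiv -foldr_cat; exact: sf. Qed.

Lemma smooth_translation t f : smooth f -> smooth (translation t f).
Proof.
move=> /smoothP sf; apply/smoothP => s; rewrite iter_pderiv_translation.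
have [[c1 c2] df] := sf s.
have ct : continuous (fun x : 'rV[R]_d => x - t).
  move=> x; apply: (@continuousB _ _ _ id (fun=> t) x); first exact: cvg_id.
  exact: cst_continuous.
split.
  by split=> x; [apply: (continuous_comp (ct x) (c1 _))|apply: (continuous_comp (ct x) (c2 _))].
move=> i x; have [d1 d2] := df i (x - t).
split; [move: d1|move: d2]; rewrite /derivable /translation;
  by under eq_fun do rewrite /= addrA.
Qed.

(* [modulation xi] conjugates [pderiv i] into this operator. *)
Definition twisted_pderiv xi i f : 'rV[R]_d -> R[i] :=
  fun x => (0 +i* xi 0 i) * f x + pderiv i f x.

Lemma smooth_twisted_pderiv xi s f : smooth f -> smooth (foldr (twisted_pderiv xi) f s).
Proof.
move=> sf; elim: s => //= i s IHs.
by apply: smooth_lin => //; exact: (smooth_iter_pderiv [:: i]).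
Qed.

(** Leibniz's rule in unexpanded form: the operators d_i + i xi_i remain a fold. *)
Lemma iter_pderiv_modulation xi f s : smooth f ->
  iter_pderiv s (modulation xi f) = modulation xi (foldr (twisted_pderiv xi) f s).
Proof.
move=> sf; elim: s => //= i s ->; apply/funext => x.
apply/has_pderiv_val/has_pderiv_modulation.
exact: (smooth_pderivable [::]) (smooth_twisted_pderiv _ _ _).
Qed.

Lemma smooth_modulation xi f : smooth f -> smooth (modulation xi f).
Proof.
move=> sf; apply/smoothP => s; rewrite iter_pderiv_modulation//.
have /smoothP/(_ [::])[/= cf df] := smooth_twisted_pderiv xi s sf.
split; first exact: ccontinuous_modulation.
move=> i x; have /partially_derivableP h := df i x.
by have [] := has_pderiv_modulation xi h; split.
Qed.

End Derivatives.

(** * Trigonometric transforms of rapidly decreasing functions *)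

Section Trigonometric.
Context {R : realType}.
Implicit Types (k : R -> R) (a b h : R).

(** The mean value theorem for increments of either sign; for h < 0 it is applied on [a + h, a]. *)
Lemma derive_increment k (k' : R -> R) a h : (forall x : R, is_derive x 1 k (k' x)) ->
  exists2 c, `|c - a| <= `|h| & k (a + h) - k a = k' c * h.
Proof.
move=> dk.
have ck x : {for x, continuous k}.
  by apply: differentiable_continuous; apply/derivable1_diffP; case: (dk x).
have mvt u v : u <= v -> exists2 c, c \in `[u, v] & k v - k u = k' c * (v - u).
  by move=> uv; apply: MVT_segment => //; exact: continuous_subspaceT.
have [h0|h0] := leP 0 h.
  have [|c] := mvt a (a + h); first by rewrite lerDl.
  rewrite in_itv/= => /andP[ac ca] ->; exists c; last by rewrite addrC addKr.
  by rewrite !ger0_norm ?subr_ge0// lerBlDl.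
have [|c] := mvt (a + h) a; first by rewrite gerDl ltW.
rewrite in_itv/= => /andP[ac ca] e; exists c.
  by rewrite ler0_norm ?subr_le0// ltr0_norm// opprB; lra.
by rewrite -opprB e opprD addNKr mulrN opprK.
Qed.

(** What integration asks of cosine and sine, so that one argument treats both: a bound, a Lipschitz
    estimate, and a Taylor remainder uniform in the base point. *)
Definition trig_pair k (k' : R -> R) := [/\ forall a, `|k a| <= 1,
  forall a b, `|k a - k b| <= `|a - b| &
  forall a h, `|k (a + h) - k a - h * k' a| <= h ^+ 2].

(** For the remainder, k(a + h) - k(a) = k'(c) h with |c - a| <= |h|, and k' is itself
    1-Lipschitz. *)
Lemma trig_pairP k (k' k'' : R -> R) :
  (forall x : R, is_derive x 1 k (k' x)) -> (forall x : R, is_derive x 1 k' (k'' x)) ->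
  (forall a, `|k a| <= 1) -> (forall a, `|k' a| <= 1) -> (forall a, `|k'' a| <= 1) ->
  trig_pair k k'.
Proof.
move=> dk dk' k1 k'1 k''1.
have lip (f f' : R -> R) a b : (forall x : R, is_derive x 1 f (f' x)) -> (forall a, `|f' a| <= 1) ->
    `|f a - f b| <= `|a - b|.
  move=> df f1; have [c _] := derive_increment b (a - b) df.
  by rewrite subrKC => ->; rewrite normrM ler_piMl.
split=> // a h; first exact: lip.
have [c ca ->] := derive_increment a h dk.
rewrite mulrC -mulrBr normrM -(real_normK (num_real h)) expr2 ler_wpM2l//.
exact: le_trans (lip _ _ _ _ dk' k''1) ca.
Qed.

Lemma trig_pair_cos : trig_pair cos (fun a : R => - sin a).
Proof.
apply: (@trig_pairP _ _ (fun a => - cos a)) ; rewrite /=.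
- exact: cos_max.
- by move=> a; rewrite normrN sin_max.
- by move=> a; rewrite normrN cos_max.
Qed.

Lemma trig_pair_sin : trig_pair sin (@cos R).
Proof.
apply: (@trig_pairP _ _ (fun a => - sin a)) ; rewrite /=.
- exact: sin_max.
- exact: cos_max.
- by move=> a; rewrite normrN sin_max.
Qed.

Lemma trig_pair_continuous k (k' : R -> R) : trig_pair k k' -> continuous k.
Proof.
move=> [_ lip _] x; apply/cvgrPdist_le => e e0; near=> y.
rewrite (le_trans (lip _ _))//; near: y.
Unshelve. all: by end_near. Qed.

Lemma lipschitz_continuous (V : normedModType R) (F : V -> R) K :
  (forall x y, `|F x - F y| <= K * `|x - y|) -> continuous F.
Proof.
move=> lip x; apply/cvgrPdist_le => e e0; near=> y.
rewrite (le_trans (lip _ _))//.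
(* A positive divisor, whatever the sign of [K]. *)
have K0 : 0 < `|K| + 1 by rewrite ltr_wpDl.
apply: (@le_trans _ _ ((`|K| + 1) * `|x - y|)).
  by rewrite ler_wpM2r// (le_trans (ler_norm _))// lerDl.
rewrite -ler_pdivlMl// mulrC; near: y; apply: cvgr_dist_le; first exact: cvg_id.
by rewrite divr_gt0.
Unshelve. all: by end_near. Qed.

(** Division by h leaves an error of order |h|. This turns a bound on integrated remainders into a
    derivative. *)
Lemma is_derive_quadratic (V : normedModType R) (F : V -> R) x v l K :
  (forall h : R, `|F (h *: v + x) - F x - h * l| <= K * h ^+ 2) ->
  is_derive x v F l.
Proof.
move=> hF.
suff cl : (fun h : R => h^-1 *: ((F \o shift x) (h *: v) - F x)) @ 0^' --> l.
  apply: DeriveDef; first by apply: cvgP; exact: cl.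
  exact: cvg_lim cl.
apply/cvgrPdist_le => e e0; near=> h.
have h0 : h != 0 by near: h; exact: nbhs_dnbhs_neq.
have K0 : 0 < `|K| + 1 by rewrite ltr_wpDl.
have -> : l - h^-1 *: ((F \o shift x) (h *: v) - F x) =
    - (h^-1 * (F (h *: v + x) - F x - h * l)).
  by rewrite mulrBr mulKf// opprB.
rewrite normrN normrM (@le_trans _ _ (`|h^-1| * ((`|K| + 1) * h ^+ 2)))//.
  rewrite ler_wpM2l// (le_trans (hF h))// ler_wpM2r ?sqr_ge0//.
  by rewrite (le_trans (ler_norm _))// lerDl.
rewrite normfV -(real_normK (num_real h)) expr2 mulrCA mulKf ?normr_eq0//.
rewrite -ler_pdivlMl// mulrC; near: h.
apply: dnbhs0_le; by rewrite divr_gt0.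
Unshelve. all: by end_near. Qed.

End Trigonometric.

(** * Rapidly decreasing functions and their cosine and sine transforms *)

Section Rapid.
Context {R : realType} {d : nat}.
Implicit Types (p q : 'rV[R]_d -> R) (x xi : 'rV[R]_d) (k : R -> R).

Notation rowt t := (\row_i tnth t i).

Lemma coord_le_norm x i : `|x 0 i| <= `|x|.
Proof.
by rewrite [leRHS]/Num.norm /= mx_normrE; apply/bigmax_geP; right; exists (0, i).
Qed.

(** Decay with no condition on derivatives: the class is stable under coordinates and bounded
    continuous factors, as the Fourier integrals require. *)
Definition rapid p := continuous p /\ forall b : {ffun 'I_d -> nat},
  exists C, forall x, `|\prod_i x 0 i ^+ b i| * `|p x| <= C.

Lemma rapidD p q : rapid p -> rapid q -> rapid (fun x => p x + q x).
Proof.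
move=> [cp bp] [cq bq]; split; first by move=> x; exact: continuousD (cp x) (cq x).
move=> b; have [C hC] := bp b; have [D hD] := bq b; exists (C + D) => x.
by rewrite (le_trans _ (lerD (hC x) (hD x)))// -mulrDr ler_wpM2l// ler_normD.
Qed.

Lemma rapidMl p (u : 'rV[R]_d -> R) K : continuous u -> (forall x, `|u x| <= K) ->
  rapid p -> rapid (fun x => u x * p x).
Proof.
move=> cu uK [cp bp]; split; first by move=> x; exact: continuousM (cu x) (cp x).
move=> b; have [C hC] := bp b; exists (K * C) => x.
by rewrite normrM mulrCA ler_pM// mulr_ge0.
Qed.

Lemma rapidZ p a : rapid p -> rapid (fun x => a * p x).
Proof. by apply: rapidMl; [exact: cst_continuous|move=> x; exact: lexx]. Qed.

Lemma rapid_norm p : rapid p -> rapid (fun x => `|p x|).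
Proof.
move=> [cp bp]; split.
  by move=> x; apply: (continuous_comp (cp x)); exact: norm_continuous.
by move=> b; have [C hC] := bp b; exists C => x; rewrite normr_id.
Qed.

Lemma rapid_coord p j : rapid p -> rapid (fun x => x 0 j * p x).
Proof.
move=> [cp bp]; split.
  by move=> x; exact: continuousM (@coord_continuous _ _ _ _ _ x) (cp x).
move=> b; have [C hC] := bp [ffun i => (b i + (i == j))%N]; exists C => x.
rewrite normrM mulrA -normrM (le_trans _ (hC x))// ler_wpM2r// le_eqVlt.
apply/orP; left; apply/eqP; congr (`|_|).
under [in RHS]eq_bigr do rewrite ffunE exprD.
rewrite big_split/=; congr (_ * _).
rewrite (bigD1 j)//= eqxx expr1 big1 ?mulr1// => i /negbTE ->.
by rewrite expr0.
Qed.

Lemma rapid_sum (r : seq 'I_d) (p : 'I_d -> 'rV[R]_d -> R) :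
  (exists q, rapid q) ->
  (forall i, rapid (p i)) -> rapid (fun x => \sum_(i <- r) p i x).
Proof.
move=> [q rq] rp; elim: r => [|i r IHr].
  (* The empty sum is obtained as the multiple 0 q. *)
  have := rapidZ 0 rq; congr rapid; apply/funext => x.
  by rewrite big_nil mul0r.
have := rapidD (rp i) IHr; congr rapid; apply/funext => x.
by rewrite big_cons.
Qed.

(** Expanding the product of the 1 + x_i^2 gives a finite sum of monomials: [f] selects the
    coordinates that contribute their square. *)
Lemma rapid_weight p : rapid p ->
  exists C, forall x, \prod_i oneDsqr (x 0 i) * `|p x| <= C.
Proof.
move=> [_ bp].
pose C (f : {ffun 'I_d -> bool}) := projT1 (cid (bp [ffun i => (f i).*2])).
exists (\sum_f C f) => x.
have -> : \prod_i oneDsqr (x 0 i) = \sum_(f : {ffun 'I_d -> bool})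
    \prod_i x 0 i ^+ (f i).*2.
  rewrite -(bigA_distr_bigA (fun (i : 'I_d) (b : bool) => x 0 i ^+ b.*2)).
  by apply: eq_bigr => i _; rewrite big_bool/= expr0 addrC.
rewrite mulr_suml; apply: ler_sum => f _.
rewrite /C; case: cid => /= K /(_ x); apply: le_trans.
under [in leRHS]eq_bigr do rewrite ffunE.
by rewrite ler_wpM2r// ler_norm.
Qed.

Lemma rapid_integrable p : rapid p ->
  (@lebesgue_tuple R d).-integrable setT (EFin \o (fun t => p (rowt t))).
Proof.
by move=> rp; have [C hC] := rapid_weight rp; apply: integrable_row hC; case: rp.
Qed.

(** Convertible with either component of [cintegral]. *)
Definition row_integral p : R := \int[@lebesgue_tuple R d]_t p (rowt t).

(** This single rule also serves for plain multiples, written c p = (c - 1) p + p. *)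
Lemma row_integral_lin p q a : rapid p -> rapid q ->
  row_integral (fun x => a * p x + q x) = a * row_integral p + row_integral q.
Proof.
move=> rp rq; rewrite /row_integral RintegralD//.
- by rewrite RintegralZl//; exact: rapid_integrable.
- exact: (rapid_integrable (rapidZ a rp)).
- exact: rapid_integrable.
Qed.

Lemma le_norm_row_integral p q : rapid p -> rapid q -> (forall x, `|p x| <= q x) ->
  `|row_integral p| <= row_integral q.
Proof.
move=> rp rq pq; rewrite (le_trans (le_normr_Rintegral _ _))//.
  exact: rapid_integrable.
apply: le_Rintegral => //.
  exact: (rapid_integrable (rapid_norm rp)).
exact: rapid_integrable.
Qed.

Lemma row_integral_shift p a : continuous p -> row_integral (fun x => p (x + a)) = row_integral p.
Proof.
move=> cp; rewrite /row_integral /Rintegral; congr fine.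
rewrite -[RHS](integral_tuple_shift (fun i => a 0 i)).
  apply: eq_integral => t _; congr (p _)%:E; apply/rowP => i.
  by rewrite !mxE tnth_mktuple.
by apply/measurable_EFinP; exact: measurable_continuous_row.
Qed.

Definition trig_transform k p xi := row_integral (fun x => k (dotp x xi) * p x).

Lemma rapid_trig k (k' : R -> R) p xi : trig_pair k k' -> rapid p ->
  rapid (fun x => k (dotp x xi) * p x).
Proof.
move=> kk'; apply: (@rapidMl p _ 1); last by case: kk' => + _ _ x; exact.
move=> x; apply: (continuous_comp (@continuous_dotp _ _ xi x)).
exact: trig_pair_continuous kk' _.
Qed.

(** The transform is Lipschitz, with constant the integral of the sum of the |x_i p(x)|, since the
    dot product of x and xi - eta is at most the sum of the |x_i| times the sup norm of xi - eta. *)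
Lemma continuous_trig_transform k (k' : R -> R) p : trig_pair k k' -> rapid p ->
  continuous (trig_transform k p).
Proof.
move=> kk' rp; have [_ lip _] := kk'.
have rs : rapid (fun x => \sum_i `|x 0 i * p x|).
  apply: rapid_sum; first by exists p.
  by move=> i; apply/rapid_norm/rapid_coord.
apply: (@lipschitz_continuous _ _ _ (row_integral (fun x => \sum_i `|x 0 i * p x|))) => xi eta.
rewrite /trig_transform; set u := fun x => _; set v := fun x => _.
have ru : rapid u by exact: rapid_trig kk' rp.
have rv : rapid v by exact: rapid_trig kk' rp.
have -> : row_integral u - row_integral v = row_integral (fun x => (-1) * v x + u x).
  by rewrite row_integral_lin// mulN1r addrC.
have -> : row_integral (fun x => \sum_i `|x 0 i * p x|) * `|xi - eta| =
   row_integral (fun x => (`|xi - eta| - 1) * (\sum_i `|x 0 i * p x|) + \sum_i `|x 0 i * p x|).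
  by rewrite row_integral_lin// mulrBl mul1r subrK mulrC.
apply: le_norm_row_integral; [exact: rapidD (rapidZ _ _) _|exact: rapidD (rapidZ _ _) _|].
move=> x; rewrite /u /v mulN1r addrC -mulrBl normrM.
rewrite mulrBl mul1r subrK (le_trans (ler_wpM2r _ (lip _ _)))//.
have -> : dotp x xi - dotp x eta = \sum_i x 0 i * (xi - eta) 0 i.
  by rewrite /dotp -sumrB; apply: eq_bigr => i _; rewrite !mxE mulrBr.
rewrite (le_trans (ler_wpM2r _ (ler_norm_sum _ _ _)))// mulr_suml mulr_sumr.
apply: ler_sum => i _; rewrite !normrM mulrAC mulrC ler_wpM2r ?mulr_ge0//.
exact: coord_le_norm.
Qed.

(** Integrating the Taylor estimate with increment h x_j leaves at most h^2 times the integral of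
    |x_j^2 p|. The hypothesis on [k'] is separate because [trig_pair] says nothing of the size of
    [k']. *)
Lemma is_derive_trig_transform k (k' : R -> R) p xi j : trig_pair k k' ->
  (forall eta q, rapid q -> rapid (fun x => k' (dotp x eta) * q x)) -> rapid p ->
  is_derive xi (delta_mx 0 j) (trig_transform k p)
    (trig_transform k' (fun x => x 0 j * p x) xi).
Proof.
move=> kk' rk' rp; have [_ _ hk] := kk'.
pose w x := `|x 0 j * (x 0 j * p x)|.
have rw : rapid w by apply/rapid_norm/rapid_coord/rapid_coord.
apply: (@is_derive_quadratic _ _ _ _ _ _ (row_integral w)) => h.
rewrite /trig_transform; set u := fun x => _; set v := fun x => _.
set z := fun x => k' _ * _.
have ru : rapid u by exact: rapid_trig kk' rp.
have rv : rapid v by exact: rapid_trig kk' rp.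
have rz : rapid z by apply/rk'/rapid_coord.
have -> : row_integral u - row_integral v - h * row_integral z =
    row_integral (fun x => (- h) * z x + ((-1) * v x + u x)).
  rewrite row_integral_lin//; last exact: rapidD (rapidZ _ _) _.
  by rewrite row_integral_lin//; ring.
have -> : row_integral w * h ^+ 2 = row_integral (fun x => (h ^+ 2 - 1) * w x + w x).
  by rewrite row_integral_lin// mulrBl mul1r subrK mulrC.
apply: le_norm_row_integral.
- exact: rapidD (rapidZ _ _) (rapidD (rapidZ _ _) _).
- exact: rapidD (rapidZ _ _) _.
move=> x; rewrite mulrBl mul1r subrK /u /v /z /w.
have -> : dotp x (h *: delta_mx 0 j + xi) = dotp x xi + h * x 0 j.
  by rewrite dotpC dotpDl dotpZl dotp_delta addrC (dotpC xi).
set a := dotp x xi; set y := x 0 j.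
have -> : - h * (k' a * (y * p x)) + (-1 * (k a * p x) + k (a + h * y) * p x) =
  (k (a + h * y) - k a - (h * y) * k' a) * p x by ring.
rewrite normrM (le_trans (ler_wpM2r _ (hk _ _)))//.
by rewrite exprMn !normrM -(real_normK (num_real y)) expr2 !mulrA.
Qed.

End Rapid.

(** * Fourier transform *)

Section Fourier.
Context {R : realType} {d : nat}.
Implicit Types (f g : 'rV[R]_d -> R[i]) (x xi t : 'rV[R]_d) (c : R[i]).

Local Notation RE f := (fun x => complex.Re (f x)).
Local Notation IM f := (fun x => complex.Im (f x)).

Definition crapid f := rapid (RE f) /\ rapid (IM f).

Lemma crapid_coord f j : crapid f -> crapid (fun x => (0 +i* (- x 0 j)) * f x).
Proof.
move=> [f1 f2]; split.
  have := rapid_coord j f2; congr rapid; apply/funext => x.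
  by case: (f x) => a b /=; ring.
have := rapidZ (-1) (rapid_coord j f1); congr rapid; apply/funext => x.
by case: (f x) => a b /=; ring.
Qed.

Lemma Re_fourier f xi : crapid f -> complex.Re (fourier f xi) =
  trig_transform cos (RE f) xi + trig_transform sin (IM f) xi.
Proof.
move=> [f1 f2]; rewrite -[X in X + _]mul1r -row_integral_lin; last 2 first.
- exact: rapid_trig trig_pair_cos f1.
- exact: rapid_trig trig_pair_sin f2.
rewrite /fourier /cintegral /= -[LHS]/(row_integral (fun x => complex.Re (cexpi (- dotp x xi) * f x))).
by congr row_integral; apply/funext => x; rewrite Re_cexpiM cosN sinN mul1r mulNr opprK.
Qed.

Lemma Im_fourier f xi : crapid f -> complex.Im (fourier f xi) =
  trig_transform cos (IM f) xi - trig_transform sin (RE f) xi.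
Proof.
move=> [f1 f2]; rewrite addrC -mulN1r -row_integral_lin; last 2 first.
- exact: rapid_trig trig_pair_sin f1.
- exact: rapid_trig trig_pair_cos f2.
rewrite /fourier /cintegral /= -[LHS]/(row_integral (fun x => complex.Im (cexpi (- dotp x xi) * f x))).
by congr row_integral; apply/funext => x; rewrite Im_cexpiM cosN sinN; ring.
Qed.

Lemma ccontinuous_fourier f : crapid f -> ccontinuous (fourier f).
Proof.
move=> rf; have [f1 f2] := rf.
have cc (p : 'rV[R]_d -> R) := @continuous_trig_transform _ _ _ _ p trig_pair_cos.
have cs (p : 'rV[R]_d -> R) := @continuous_trig_transform _ _ _ _ p trig_pair_sin.
split.
  under eq_fun do rewrite Re_fourier//.
  by move=> xi; exact: continuousD (cc _ f1 xi) (cs _ f2 xi).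
under eq_fun do rewrite Im_fourier//.
by move=> xi; exact: continuousB (cc _ f2 xi) (cs _ f1 xi).
Qed.

(** In real terms cosine becomes minus sine and sine becomes cosine, each with a factor x_j; the
    resulting transforms are matched with the two components of the transform of - i x_j f. *)
Lemma has_pderiv_fourier f j xi : crapid f ->
  has_pderiv j (fourier f) xi (fourier (fun x => (0 +i* (- x 0 j)) * f x) xi).
Proof.
move=> rf; have [f1 f2] := rf; have rg := crapid_coord j rf.
have dc p : rapid p -> is_derive xi (delta_mx 0 j) (trig_transform cos p)
    (- trig_transform sin (fun x => x 0 j * p x) xi).
  move=> rp; have rjp := rapid_coord j rp.
  have rNs eta q : rapid q -> rapid (fun x => - sin (dotp x eta) * q x).
    move=> rq; have := rapidZ (-1) (rapid_trig eta trig_pair_sin rq).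
    by congr rapid; apply/funext => x; ring.
  have := @is_derive_trig_transform _ _ _ _ _ xi j trig_pair_cos rNs rp.
  congr is_derive.
  rewrite -mulN1r -[RHS]addr0 -(mul0r (trig_transform sin (fun x => x 0 j * p x) xi)).
  have rs := rapid_trig xi trig_pair_sin rjp.
  rewrite /trig_transform -mulrDl addr0.
  (* The sign is written - I = (-2) I + I to fit [row_integral_lin]. *)
  rewrite (_ : -1 * _ = (-2) * row_integral (fun x => sin (dotp x xi) * (x 0 j * p x))
    + row_integral (fun x => sin (dotp x xi) * (x 0 j * p x))); last by ring.
  rewrite -row_integral_lin//; congr row_integral; apply/funext => x; ring.
have ds p : rapid p -> is_derive xi (delta_mx 0 j) (trig_transform sin p)
    (trig_transform cos (fun x => x 0 j * p x) xi).
  move=> rp; apply: is_derive_trig_transform trig_pair_sin _ rp => eta q.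
  exact: rapid_trig trig_pair_cos.
have gR : RE (fun x => (0 +i* (- x 0 j)) * f x) = (fun x => x 0 j * IM f x).
  by apply/funext => x; case: (f x) => a b /=; ring.
have gI : IM (fun x => (0 +i* (- x 0 j)) * f x) = (fun x => - 1 * (x 0 j * RE f x)).
  by apply/funext => x; case: (f x) => a b /=; ring.
have tN k : rapid (fun x => k (dotp x xi) * (x 0 j * RE f x)) ->
    trig_transform k (fun x => - 1 * (x 0 j * RE f x)) xi =
    - trig_transform k (fun x => x 0 j * RE f x) xi.
  move=> rk; rewrite /trig_transform.
  rewrite (_ : - row_integral _ = (-2) * row_integral (fun x => k (dotp x xi) * (x 0 j * RE f x))
    + row_integral (fun x => k (dotp x xi) * (x 0 j * RE f x))); last by ring.
  rewrite -row_integral_lin//; congr row_integral; apply/funext => x; ring.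
set g := fun x => (0 +i* (- x 0 j)) * f x.
have fR : complex.Re (fourier g xi) = - trig_transform sin (fun x => x 0 j * RE f x) xi +
    trig_transform cos (fun x => x 0 j * IM f x) xi.
  rewrite (Re_fourier xi rg) addrC -(tN sin); last exact: rapid_trig trig_pair_sin (rapid_coord j f1).
  by congr (_ + _); congr trig_transform.
have fI : complex.Im (fourier g xi) = - trig_transform sin (fun x => x 0 j * IM f x) xi -
    trig_transform cos (fun x => x 0 j * RE f x) xi.
  rewrite (Im_fourier xi rg) addrC -(tN cos); last exact: rapid_trig trig_pair_cos (rapid_coord j f1).
  by congr (- _ + _); congr trig_transform.
have dcf := dc _ f1; have dsf := ds _ f2.
have dcf2 := dc _ f2; have dsf2 := ds _ f1.
rewrite /has_pderiv fR fI; split.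
  rewrite (_ : (fun _ => _) = trig_transform cos (RE f) + trig_transform sin (IM f)); last first.
    by apply/funext => eta; exact: Re_fourier.
  exact: is_deriveD.
rewrite (_ : (fun _ => _) = trig_transform cos (IM f) - trig_transform sin (RE f)); last first.
  by apply/funext => eta; exact: Im_fourier.
exact: is_deriveB.
Qed.

(** Transforms of [crapid] functions are closed under [pderiv], so every iterated derivative is
    again one, hence continuous and partially derivable. *)
Lemma smooth_fourier f : crapid f -> smooth (fourier f).
Proof.
move=> rf; apply/smoothP => s.
suff [g [-> rg]] : exists g, iter_pderiv s (fourier f) = fourier g /\ crapid g.
  split; first exact: ccontinuous_fourier.
  by move=> i x; have [] := has_pderiv_fourier i x rg; split.
elim: s => [|i s [g [gE rg]]] /=; first by exists f.
exists (fun x => (0 +i* (- x 0 i)) * g x); split; last exact: crapid_coord.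
rewrite gE; apply/funext => x.
by apply: has_pderiv_val; exact: has_pderiv_fourier.
Qed.

Lemma cexpiD (a b : R) : cexpi (a + b) = cexpi a * cexpi b.
Proof. by rewrite /cexpi cosD sinD; congr (_ +i* _); rewrite addrC. Qed.

Lemma crapid_modulation xi f : crapid f -> crapid (modulation xi f).
Proof.
move=> [f1 f2].
have rc p : rapid p -> rapid (fun x => cos (dotp x xi) * p x).
  exact: rapid_trig trig_pair_cos.
have rs p : rapid p -> rapid (fun x => sin (dotp x xi) * p x).
  exact: rapid_trig trig_pair_sin.
split.
  have := rapidD (rc _ f1) (rapidZ (-1) (rs _ f2)); congr rapid; apply/funext => x.
  by rewrite /modulation Re_cexpiM mulN1r.
have := rapidD (rc _ f2) (rs _ f1); congr rapid; apply/funext => x.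
by rewrite /modulation Im_cexpiM.
Qed.

Lemma cintegralZ c f : crapid f ->
  cintegral (fun x => c * f x) = c * cintegral f.
Proof.
move=> [f1 f2]; rewrite -[LHS]/(row_integral (fun x => complex.Re (c * f x)) +i*
  row_integral (fun x => complex.Im (c * f x))).
rewrite -[cintegral f]/(row_integral (RE f) +i* row_integral (IM f)).
case: c => a b; congr (_ +i* _).
  rewrite -mulNr addrC -(mul1r (a * _)) -[RHS]/(- b * _ + _).
  have -> : - b * row_integral (IM f) + 1 * (a * row_integral (RE f)) =
    - b * row_integral (IM f) + ((a - 1) * row_integral (RE f) + row_integral (RE f)) by ring.
  rewrite -row_integral_lin// -row_integral_lin//; last exact: rapidD (rapidZ _ _) _.
  by congr row_integral; apply/funext => x; case: (f x) => u v /=; ring.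
have -> : a * row_integral (IM f) + b * row_integral (RE f) =
  b * row_integral (RE f) + ((a - 1) * row_integral (IM f) + row_integral (IM f)) by ring.
rewrite -row_integral_lin// -row_integral_lin//; last exact: rapidD (rapidZ _ _) _.
by congr row_integral; apply/funext => x; case: (f x) => u v /=; ring.
Qed.

Lemma fourierZ c f : crapid f -> fourier (fun x => c * f x) = (fun xi => c * fourier f xi).
Proof.
move=> rf; apply/funext => xi; rewrite /fourier.
rewrite -cintegralZ; last first.
  have := crapid_modulation (- xi) rf; congr crapid; apply/funext => x.
  by rewrite /modulation -dotpN.
by congr cintegral; apply/funext => x; rewrite mulrCA.
Qed.

Lemma fourier_modulation xi f :
  fourier (modulation xi f) = translation xi (fourier f).
Proof.
apply/funext => eta; congr cintegral; apply/funext => x.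
rewrite /modulation mulrA -cexpiD; congr (cexpi _ * _).
by rewrite !(dotpC x) dotpBl opprB addrC.
Qed.

Lemma fourier_translation t f : crapid f ->
  fourier (translation t f) = modulation (- t) (fourier f).
Proof.
move=> rf; apply/funext => xi; rewrite /fourier /modulation.
have rm : crapid (fun x => cexpi (- dotp x xi) * f x).
  have := crapid_modulation (- xi) rf; congr crapid; apply/funext => x.
  by rewrite /modulation -dotpN.
rewrite -cintegralZ//.
set g := fun x => cexpi (dotp xi (- t)) * _.
have cg : ccontinuous g.
  have [[c1 _] [c2 _]] := rm.
  have := @ccontinuous_lin _ _ (cexpi (dotp xi (- t)) - 1)
    (fun x => cexpi (- dotp x xi) * f x) _ (conj c1 c2) (conj c1 c2).
  by congr ccontinuous; apply/funext => x; rewrite mulrBl mul1r subrK.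
rewrite -[RHS]/(row_integral (RE g) +i* row_integral (IM g)).
(* Replacing x by x - t in [g] produces the integrand on the left. *)
rewrite -(row_integral_shift (- t) (proj1 cg)) -(row_integral_shift (- t) (proj2 cg)).
rewrite -[RHS]/(cintegral (fun x => g (x - t))).
congr cintegral; apply/funext => x; rewrite /g /translation mulrA -cexpiD.
congr (cexpi _ * _); rewrite dotpBl dotpN (dotpC xi t); ring.
Qed.

End Fourier.

(** * Weights and cones *)

Section EuclideanNorm.
Context {R : realType}.

Lemma dotp_ge0 d (x : 'rV[R]_d) : 0 <= dotp x x.
Proof. by apply: sumr_ge0 => i _; rewrite -expr2 sqr_ge0. Qed.

Lemma dotpDr d (x y z : 'rV[R]_d) : dotp x (y + z) = dotp x y + dotp x z.
Proof. by rewrite dotpC dotpDl !(dotpC x). Qed.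

(** The polynomial |x + a y|^2 in a is nonnegative; for y nonzero it is evaluated at its minimum. *)
Lemma cauchy_schwarz_dotp d (x y : 'rV[R]_d) :
  dotp x y ^+ 2 <= dotp x x * dotp y y.
Proof.
have Q (a : R) : 0 <= dotp x x + 2 * a * dotp x y + a ^+ 2 * dotp y y.
  have := dotp_ge0 (x + a *: y); congr (0 <= _).
  rewrite dotpDl !dotpDr !dotpZl (dotpC x (a *: y)) (dotpC y (a *: y)) !dotpZl.
  by rewrite (dotpC y x); ring.
have [C0|C0] := eqVneq (dotp y y) 0.
  have [->|B0] := eqVneq (dotp x y) 0; first by rewrite expr0n mulr_ge0 ?dotp_ge0.
  (* Here the polynomial is affine in a, and this value of a makes it - 1. *)
  have := Q (- (dotp x x + 1) / (2 * dotp x y)).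
  rewrite C0 mulr0 addr0 (_ : 2 * _ * _ = - (dotp x x + 1)).
    by rewrite opprD addNKr oppr_ge0 ler10.
  by field.
have C1 : 0 < dotp y y by rewrite lt0r C0 dotp_ge0.
have := Q (- dotp x y / dotp y y).
rewrite (_ : _ + _ + _ = (dotp x x * dotp y y - dotp x y ^+ 2) / dotp y y).
  by rewrite pmulr_lge0 ?invr_gt0// subr_ge0.
by field.
Qed.

Lemma enorm_ge0 d (x : 'rV[R]_d) : 0 <= enorm x.
Proof. exact: sqrtr_ge0. Qed.

Lemma enormD d (x y : 'rV[R]_d) : enorm (x + y) <= enorm x + enorm y.
Proof.
rewrite -(ler_pXn2r (ltn0Sn 1)) ?nnegrE ?addr_ge0 ?enorm_ge0//.
rewrite sqrrD !sqr_sqrtr ?dotp_ge0// dotpDl !dotpDr (dotpC y x).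
have : dotp x y <= enorm x * enorm y.
  rewrite (le_trans (ler_norm _))// -sqrtr_sqr /enorm -sqrtrM ?dotp_ge0//.
  by rewrite ler_wsqrtr// cauchy_schwarz_dotp.
by rewrite mulr2n; lra.
Qed.

Lemma enorm_le_coord d (x : 'rV[R]_d) r : (forall i, `|x 0 i| <= r) ->
  enorm x <= Num.sqrt (\sum_(i < d) r ^+ 2).
Proof.
move=> xr; rewrite ler_wsqrtr//; apply: ler_sum => i _.
by rewrite -expr2 -(real_normK (num_real _)) lerXn2r// nnegrE (le_trans _ (xr i)).
Qed.

Lemma coord_le_enorm d (x : 'rV[R]_d) i : `|x 0 i| <= enorm x.
Proof.
rewrite -sqrtr_sqr ler_wsqrtr// /dotp (bigD1 i)//= -expr2 lerDl.
by apply: sumr_ge0 => j _; rewrite -expr2 sqr_ge0.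
Qed.

(** Concatenation carries the weight estimates for row vectors over to phase space. *)
Lemma enorm2E d (z : 'rV[R]_d * 'rV[R]_d) : enorm2 z = enorm (row_mx z.1 z.2).
Proof.
rewrite /enorm2 /enorm; congr Num.sqrt; rewrite /dotp big_split_ord/=.
by congr (_ + _); apply: eq_bigr => i _; rewrite ?row_mxEl ?row_mxEr.
Qed.

End EuclideanNorm.

Section Weights.
Context {R : realType}.
Variable omega : R -> R.
Hypothesis homega : nonquasianalytic_subadditive_weight omega.

Lemma weight_enormD d (x y : 'rV[R]_d) :
  omega (enorm (x + y)) <= omega (enorm x) + omega (enorm y).
Proof.
rewrite (le_trans _ (weight_alpha homega (enorm_ge0 x) (enorm_ge0 y)))//.
by apply: (weight_increasing homega); [exact: enorm_ge0|exact: enormD].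
Qed.

Lemma weight_enorm_bounded d r : exists B, forall x : 'rV[R]_d,
  (forall i, `|x 0 i| <= r) -> omega (enorm x) <= B.
Proof.
exists (omega (Num.sqrt (\sum_(i < d) r ^+ 2))) => x xr.
by apply: (weight_increasing homega); [exact: enorm_ge0|exact: enorm_le_coord].
Qed.

(** Condition (gamma) with eps = 1 gives log t <= omega(t), hence t^n <= exp(n omega(t)), beyond
    some T; up to there the monomial is bounded. *)
Lemma monomial_le_weight d (b : {ffun 'I_d -> nat}) : exists lambda K,
  0 < lambda /\ forall x : 'rV[R]_d,
    `|\prod_i x 0 i ^+ b i| <= K * expR (lambda * omega (enorm x)).
Proof.
have [T [_ hT]] := weight_gamma homega ltr01.
pose n := (\sum_i b i)%N; pose M := Num.max T 1.
have M1 : 1 <= M by rewrite le_max lexx orbT.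
have M0 : 0 <= M by rewrite (le_trans ler01).
(* Taking n + 1 keeps lambda positive when n = 0. The factor M^n covers t <= M and, being at least
   1, is harmless beyond. *)
exists n.+1%:R, (M ^+ n); split=> // x; set t := enorm x.
have t0 : 0 <= t := enorm_ge0 x.
have w0 : 0 <= omega t := weight_ge0 homega t0.
have : `|\prod_i x 0 i ^+ b i| <= t ^+ n.
  rewrite normr_prod /n -prodrXr; apply: ler_prod => i _.
  by rewrite normr_ge0/= normrX lerXn2r ?nnegrE ?coord_le_enorm.
move/le_trans; apply; have [tM|Mt] := leP t M.
  rewrite (@le_trans _ _ (M ^+ n))// ?lerXn2r ?nnegrE//.
  by rewrite ler_peMr ?exprn_ge0// -expR0 ler_expR mulr_ge0.
have t1 : 0 < t by rewrite (lt_le_trans ltr01)// ltW// (le_lt_trans M1).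
have MT : T <= M by rewrite le_max lexx.
have := hT t (le_lt_trans MT Mt).
rewrite mul1r (ger0_norm w0) => /(le_trans (ler_norm _)) tw.
have : t ^+ n <= expR (n.+1%:R * omega t).
  rewrite -[t in leLHS]lnK ?posrE// -expRM_natl ler_expR.
  rewrite (@le_trans _ _ (n%:R * omega t))// ?ler_wpM2l// ler_wpM2r// ler_nat.
  exact: leqnSn.
by move/le_trans; apply; rewrite ler_peMl ?expR_ge0// exprn_ege1.
Qed.

End Weights.

(** * Decay on cones under translation *)

Section Cone.
Context {R : realType} {V : normedModType R}.
Implicit Types (w F : V -> R) (G : set V).

Definition positively_conic G := forall z (t : R), 0 < t -> G z -> G (t *: z).

(* The cone over a smaller ball around [z0]: far from the origin its translate by
   [- z1] stays in [G]; the remaining points form a bounded set. *)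
Lemma conic_decay_shift w F G z0 z1 :
  (forall z z', w (z + z') <= w z + w z') ->
  (forall r, exists B, forall z, `|z| <= r -> w z <= B) ->
  (forall z, 0 <= F z) ->
  (forall r, exists B, forall z, `|z| <= r -> F z <= B) ->
  open G -> positively_conic G -> ~ G 0 -> G z0 ->
  (forall lambda, 0 < lambda -> exists C, forall z, G z ->
    expR (lambda * w z) * F z <= C) ->
  exists G', [/\ open G', positively_conic G', ~ G' 0, G' z0 &
    forall lambda, 0 < lambda -> exists C, forall z, G' z ->
      expR (lambda * w z) * F (z - z1) <= C].
Proof.
move=> wD wB F0 FB oG cG G0 Gz0 dec.
have /nbhs_ballP[e /= e0 eG] := open_nbhs_nbhs (conj oG Gz0).
(* One half of e is for the direction v, the other for the displacement z1 / t. *)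
pose D := e / 2; have D0 : 0 < D by rewrite divr_gt0.
have De : D + D = e by rewrite /D -splitr.
have ballG v : `|z0 - v| < e -> G v by move=> h; apply: eG; rewrite -ball_normE.
exists [set z | exists (t : R) v, [/\ 0 < t, `|z0 - v| < D & z = t *: v]]; split.
- rewrite openE => z [t [v [t0 vD ->]]]; apply/nbhs_ballP.
  exists (t * (D - `|z0 - v|)); first by rewrite /= mulr_gt0// subr_gt0.
  move=> y; rewrite -ball_normE /= => hy; exists t, (t^-1 *: y); split=> //.
    rewrite -(subrKA v) (le_lt_trans (ler_normD _ _))// -ltrBrDl.
    have -> : v - t^-1 *: y = t^-1 *: (t *: v - y).
      by rewrite scalerBr scalerA mulVf ?scale1r// gt_eqF.
    by rewrite normrZ gtr0_norm ?invr_gt0// ltr_pdivrMl.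
  by rewrite scalerA divff ?scale1r// gt_eqF.
- move=> z s s0 [t [v [t0 vD ->]]]; exists (s * t), v; split=> //.
    exact: mulr_gt0.
  by rewrite scalerA.
- move=> [t [v [t0 vD /esym/eqP]]]; rewrite scaler_eq0 gt_eqF//= => /eqP v0.
  by apply: G0; rewrite -v0; apply: ballG; rewrite (lt_le_trans vD)// -De lerDl ltW.
- by exists 1, z0; split=> //; [rewrite subrr normr0|rewrite scale1r].
move=> lambda l0; have [C hC] := dec _ l0.
(* Points t v of the cone with t <= |z1| / D have norm at most r, since |v| < |z0| + D. *)
pose r := `|z1| / D * (`|z0| + D).
have [B hB] := wB r; have [A hA] := FB (r + `|z1|).
have r0 : 0 <= r.
  by apply: mulr_ge0; [apply: divr_ge0|apply: addr_ge0] => //; exact: ltW.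
have A0 : 0 <= A.
  by rewrite (le_trans (F0 0))// hA// normr0 addr_ge0.
exists (`|expR (lambda * w z1) * C| + expR (lambda * B) * A).
move=> _ [t [v [t0 vD ->]]]; have [far|near] := ltP (`|z1| / D) t.
  have Gs : G (t *: v - z1).
    have -> : t *: v - z1 = t *: (v - t^-1 *: z1).
      by rewrite scalerBr scalerA divff ?scale1r// gt_eqF.
    apply: cG => //; apply: ballG.
    rewrite opprB addrCA addrC (le_lt_trans (ler_normD _ _))// -De ltrD//.
    by rewrite normrZ gtr0_norm ?invr_gt0// ltr_pdivrMl// -ltr_pdivrMr.
  rewrite ler_wpDr ?mulr_ge0 ?expR_ge0// (le_trans _ (ler_norm _))//.
  rewrite (le_trans _ (ler_wpM2l (expR_ge0 _) (hC _ Gs)))// mulrA ler_wpM2r//.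
  (* Subadditivity in the form w(t v) <= w(z1) + w(t v - z1). *)
  by rewrite -expRD ler_expR -mulrDr ler_wpM2l ?(ltW l0)// addrC -{1}(subrK z1 (t *: v)).
have zr : `|t *: v| <= r.
  rewrite normrZ gtr0_norm// ler_pM ?(ltW t0)//.
  by rewrite -[v](subKr z0) (le_trans (ler_normB _ _))// lerD2l ltW.
rewrite ler_wpDl// ler_pM ?expR_ge0//.
  by rewrite ler_expR ler_wpM2l ?(ltW l0)// hB.
by apply: hA; rewrite (le_trans (ler_normB _ _))// lerD2r.
Qed.

End Cone.

(** * Phase-space shifts and the wave front set *)

Section ComplexModulus.
Context {R : realType}.
Implicit Types z w c : R[i].

Lemma normE_cmod z : `|z| = (cmod z)%:C.
Proof. by []. Qed.

Lemma cmod_ge0 z : 0 <= cmod z.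
Proof. by case: z => a b; exact: sqrtr_ge0. Qed.

Lemma cmodM z w : cmod (z * w) = cmod z * cmod w.
Proof. exact: ComplexField.Normc.normcM. Qed.

Lemma cmodD z w : cmod (z + w) <= cmod z + cmod w.
Proof. exact: le_normcD. Qed.

Lemma cmod_conj z : cmod (z^*)%R = cmod z.
Proof. by apply: complexI; rewrite -!normE_cmod norm_conjC. Qed.

Lemma cmod_cexpi (a : R) : cmod (cexpi a) = 1.
Proof. by rewrite /cexpi /= cos2Dsin2 sqrtr1. Qed.

Lemma cmod_Ni_exp n : cmod ((- 'i) ^+ n : R[i])%R = 1.
Proof. by apply: complexI; rewrite -normE_cmod normrX normrN normCi expr1n. Qed.

Lemma cmod_imaginary (a : R) : cmod (0 +i* a) = `|a|.
Proof. by rewrite /= expr0n add0r sqrtr_sqr. Qed.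

Lemma cmod_real (a : R) : cmod a%:C = `|a|.
Proof. by rewrite /= expr0n addr0 sqrtr_sqr. Qed.

Lemma norm_Re_le_cmod z : `|complex.Re z| <= cmod z.
Proof. by case: z => a b /=; rewrite -sqrtr_sqr ler_wsqrtr// lerDl sqr_ge0. Qed.

Lemma norm_Im_le_cmod z : `|complex.Im z| <= cmod z.
Proof. by case: z => a b /=; rewrite -sqrtr_sqr ler_wsqrtr// lerDr sqr_ge0. Qed.

End ComplexModulus.

Lemma ereal_sup_EFin_ltyP (R : realType) (T : Type) (A : set T) (F : T -> R) :
  (ereal_sup [set (F x)%:E | x in A] < +oo)%E <-> exists C, forall x, A x -> F x <= C.
Proof.
split=> [|[C hC]]; last first.
  apply: (@le_lt_trans _ _ C%:E); last exact: ltry.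
  by apply: ge_ereal_sup => _ [x Ax <-]; rewrite lee_fin; exact: hC.
have ub x : A x -> ((F x)%:E <= ereal_sup [set (F x)%:E | x in A])%E.
  by move=> Ax; apply: ereal_sup_ubound; exists x.
case: (ereal_sup _) ub => [r| |] ub // _.
  by exists r => x /ub; rewrite lee_fin.
(* A supremum of -oo means that [A] is empty, so any constant serves. *)
by exists 0 => x /ub; rewrite leeNy_eq.
Qed.

(** * Multi-indices as words of derivatives *)

Section MultiIndex.
Context {R : realType} {d : nat}.
Implicit Types (f g : 'rV[R]_d -> R[i]) (a b : {ffun 'I_d -> nat}).

Definition multi_index_seq a : seq 'I_d := flatten [seq nseq (a i) i | i <- enum 'I_d].

Lemma mpderivE a f : mpderiv a f = iter_pderiv (multi_index_seq a) f.
Proof.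
rewrite /mpderiv /multi_index_seq; elim: (enum _) => //= i r ->.
rewrite /iter_pderiv foldr_cat -/(iter_pderiv _ _).
by elim: (a i) => //= n ->.
Qed.

Lemma cmod_mderiv a f x :
  cmod (mderiv a f x) = cmod (iter_pderiv (multi_index_seq a) f x).
Proof. by rewrite /mderiv cmodM cmod_Ni_exp mul1r mpderivE. Qed.

Lemma multi_index_seq0 : multi_index_seq [ffun=> 0%N] = [::].
Proof.
by rewrite /multi_index_seq; elim: (enum _) => //= i r ->; rewrite ffunE.
Qed.

(** Seminorms control only words listed in the order of the enumeration. Deleting letters, as
    Leibniz's rule does, preserves this form. *)
Lemma subseq_multi_index s a : subseq s (multi_index_seq a) ->
  exists b, s = multi_index_seq b.
Proof.
rewrite /multi_index_seq; elim: (enum 'I_d) (enum_uniq 'I_d) s => [_ s|i r IHr].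
  by move=> /= /eqP ->; exists a.
rewrite cons_uniq => /andP[ir ur] s /= /subseqP[m ms ->].
rewrite size_cat size_nseq in ms.
have le_am : (a i <= size m)%N by rewrite ms leq_addr.
rewrite -(cat_take_drop (a i) m) mask_cat; last by rewrite size_takel// size_nseq.
have [|b bE] := IHr ur (mask (drop (a i) m) (flatten [seq nseq (a i) i | i <- r])).
  by apply/subseqP; exists (drop (a i) m) => //; rewrite size_drop ms addKn.
pose k := size (mask (take (a i) m) (nseq (a i) i)).
(* [k] letters i survive the mask, and [b] counts the survivors in [r], where i does not occur. *)
exists [ffun j => if j == i then k else b j].
rewrite ffunE eqxx bE; congr (_ ++ _).
  apply/all_pred1P; apply/allP => j /mem_mask; rewrite mem_nseq => /andP[_ /eqP ->].
  exact: eqxx.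
congr flatten; apply/eq_in_map => j jr; rewrite ffunE ifN//.
by apply: contraNneq ir => <-.
Qed.

End MultiIndex.

Section PhaseShifts.
Context {R : realType} {d : nat}.
Implicit Types (f g : 'rV[R]_d -> R[i]) (x xi t : 'rV[R]_d) (W : 'rV[R]_d -> R).

(** Expanding the operators d_i + i xi_i yields subwords of the original word with coefficients
    bounded through r. The prefix [p] stores the derivatives already chosen. *)
Lemma twisted_pderiv_bound W f p s r : smooth f -> (forall x, 0 <= W x) ->
  (forall s', subseq s' (p ++ s) ->
    exists C, forall x, W x * cmod (iter_pderiv s' f x) <= C) ->
  exists C, forall xi, (forall i, `|xi 0 i| <= r) -> forall x,
    W x * cmod (iter_pderiv p (foldr (twisted_pderiv xi) f s) x) <= C.
Proof.
move=> sf W0; elim: s p => [|i s IHs] p bd.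
  have [|C hC] := bd p; first by rewrite cats0.
  by exists C => xi _ x; exact: hC.
(* Choosing the derivative appends i to [p]; the second bound, with [p] unchanged, drops i at the
   price of a factor |xi_i| <= r. *)
have [|C hC] := IHs (rcons p i); first by rewrite cat_rcons.
have [|D hD] := IHs p.
  move=> s' ss'; apply: bd; apply: (subseq_trans ss').
  by apply: cat_subseq => //; exact: subseq_cons.
exists (r * D + C) => xi hxi x /=; set E := foldr _ f s.
have sE : smooth E by exact: smooth_twisted_pderiv.
rewrite -[twisted_pderiv xi i E]/(fun x => (0 +i* xi 0 i) * E x + pderiv i E x).
rewrite iter_pderiv_lin//; last exact: (smooth_iter_pderiv [:: i]).
have -> : iter_pderiv p (pderiv i E) = iter_pderiv (rcons p i) E.
  by rewrite /iter_pderiv foldr_rcons.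
rewrite (le_trans (ler_wpM2l (W0 x) (cmodD _ _)))// mulrDr lerD ?hC//.
rewrite cmodM cmod_imaginary mulrCA ler_pM//; first by rewrite mulr_ge0 ?cmod_ge0.
exact: hD.
Qed.

Lemma foldr_twisted_translation xi t f s :
  foldr (twisted_pderiv xi) (translation t f) s =
  translation t (foldr (twisted_pderiv xi) f s).
Proof.
elim: s => //= i s ->; rewrite /twisted_pderiv pderiv_translation.
by apply/funext.
Qed.

Lemma cmod_iter_pderiv_modulation_translation xi t f s x : smooth f ->
  cmod (iter_pderiv s (modulation xi (translation t f)) x) =
  cmod (foldr (twisted_pderiv xi) f s (x - t)).
Proof.
move=> sf; rewrite iter_pderiv_modulation; last exact: smooth_translation.
by rewrite /modulation cmodM cmod_cexpi mul1r foldr_twisted_translation.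
Qed.

(** The modulus erases the phase, so this order, which occurs on the Fourier side, gives the same
    expression as the order in [phase_shift]. *)
Lemma cmod_iter_pderiv_translation_modulation xi t f s x : smooth f ->
  cmod (iter_pderiv s (translation t (modulation xi f)) x) =
  cmod (foldr (twisted_pderiv xi) f s (x - t)).
Proof.
move=> sf; rewrite iter_pderiv_translation iter_pderiv_modulation//.
by rewrite /translation /modulation cmodM cmod_cexpi mul1r.
Qed.

Variable omega : R -> R.
Hypothesis homega : nonquasianalytic_subadditive_weight omega.

Definition weight_decay f := forall lambda a, 0 < lambda -> exists C, forall x,
  expR (lambda * omega (enorm x)) * cmod (iter_pderiv (multi_index_seq a) f x) <= C.

Lemma wseminorm_ltyP lambda a f : (wseminorm omega lambda a f < +oo)%E <->
  exists C, forall x,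
    expR (lambda * omega (enorm x)) * cmod (iter_pderiv (multi_index_seq a) f x) <= C.
Proof.
rewrite /wseminorm; split=> [/ereal_sup_EFin_ltyP[C hC]|[C hC]].
  by exists C => x; rewrite -cmod_mderiv; exact: hC.
by apply/ereal_sup_EFin_ltyP; exists C => x _; rewrite cmod_mderiv.
Qed.

Lemma wseminorm_le lambda a f C : (forall x,
    expR (lambda * omega (enorm x)) * cmod (iter_pderiv (multi_index_seq a) f x) <= C) ->
  (wseminorm omega lambda a f <= C%:E)%E.
Proof.
by move=> hC; apply: ge_ereal_sup => _ [x _ <-]; rewrite lee_fin cmod_mderiv.
Qed.

(** By subadditivity a translation by t costs at most exp(lambda omega(t)), which is bounded for
    bounded t. *)
Lemma twisted_translation_bound f lambda a r : smooth f -> weight_decay f ->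
  0 < lambda -> exists C, forall xi t,
    (forall i, `|xi 0 i| <= r) -> (forall i, `|t 0 i| <= r) -> forall x,
    expR (lambda * omega (enorm x)) *
      cmod (foldr (twisted_pderiv xi) f (multi_index_seq a) (x - t)) <= C.
Proof.
move=> sf df l0.
have [|s' /subseq_multi_index[b ->]|C hC] :=
    @twisted_pderiv_bound (fun x => expR (lambda * omega (enorm x))) f [::]
      (multi_index_seq a) r sf.
- by move=> x; exact: expR_ge0.
- exact: df.
have [B hB] := weight_enorm_bounded homega d r.
exists (expR (lambda * B) * `|C|) => xi t hxi ht x.
rewrite (@le_trans _ _ (expR (lambda * B) * (expR (lambda * omega (enorm (x - t))) *
  cmod (foldr (twisted_pderiv xi) f (multi_index_seq a) (x - t)))))//.
  rewrite mulrA -expRD -mulrDr ler_wpM2r ?cmod_ge0// ler_expR ler_wpM2l ?(ltW l0)//.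
  rewrite -{1}(subrK t x) addrC (le_trans (weight_enormD homega _ _))//.
  by rewrite lerD2r hB.
by rewrite ler_wpM2l ?expR_ge0// (le_trans _ (ler_norm _))// hC.
Qed.

Lemma schwartz_crapid f : schwartz f -> crapid f.
Proof.
move=> [sf bf].
have [cR cI _] := sf [::].
have bd (b : {ffun 'I_d -> nat}) : exists C, forall x, `|\prod_i x 0 i ^+ b i| * cmod (f x) <= C.
  have /ereal_sup_EFin_ltyP[C hC] := bf [ffun=> 0%N] b; exists C => x.
  by have := hC x I; rewrite cmod_mderiv multi_index_seq0.
split; split=> // b; have [C hC] := bd b; exists C => x;
  rewrite (le_trans _ (hC x))// ler_wpM2l//.
  exact: norm_Re_le_cmod.
exact: norm_Im_le_cmod.
Qed.

(** For the converse, [monomial_le_weight] turns the weighted bounds on f into Schwartz bounds. *)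
Lemma SomegaP f : Somega omega f <->
  [/\ smooth f, weight_decay f & weight_decay (fourier f)].
Proof.
split=> [[sf wf]|[sf df dff]].
  split; [by case: sf| |] => lambda a l0;
    apply/wseminorm_ltyP; by have [] := wf lambda a l0.
split; last by move=> lambda a l0; split; apply/wseminorm_ltyP; [exact: df|exact: dff].
split=> // a b; apply/ereal_sup_EFin_ltyP.
have [lambda [K [l0 hK]]] := monomial_le_weight homega b.
have [C hC] := df lambda a l0; exists (`|K| * C) => x _.
rewrite cmod_mderiv (le_trans (ler_wpM2r (cmod_ge0 _) (hK x)))// -mulrA.
rewrite (@le_trans _ _ (`|K| * (expR (lambda * omega (enorm x)) *
  cmod (iter_pderiv (multi_index_seq a) f x))))//.
  by rewrite ler_wpM2r ?ler_norm// mulr_ge0 ?expR_ge0 ?cmod_ge0.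
by rewrite ler_wpM2l.
Qed.

Lemma fourier_phase_shift (z : 'rV[R]_d * 'rV[R]_d) f : crapid f ->
  fourier (phase_shift z f) = translation z.2 (modulation (- z.1) (fourier f)).
Proof. by move=> rf; rewrite fourier_modulation fourier_translation. Qed.

Lemma coord_le_norm_pair (z : 'rV[R]_d * 'rV[R]_d) r : `|z| <= r ->
  (forall i, `|z.1 0 i| <= r) /\ (forall i, `|z.2 0 i| <= r).
Proof.
rewrite prod_normE ge_max => /andP[z1 z2].
by split=> i; [apply: le_trans z1|apply: le_trans z2]; exact: coord_le_norm.
Qed.

(** On the Fourier side the shift by (t, xi) becomes T_xi M_(-t), so the same estimate applies to f^
    with the two components exchanged. *)
Lemma phase_shift_decay f lambda a r : Somega omega f -> 0 < lambda ->
  exists C, forall z : 'rV[R]_d * 'rV[R]_d, `|z| <= r -> forall x,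
    expR (lambda * omega (enorm x)) *
      cmod (iter_pderiv (multi_index_seq a) (phase_shift z f) x) <= C /\
    expR (lambda * omega (enorm x)) *
      cmod (iter_pderiv (multi_index_seq a) (fourier (phase_shift z f)) x) <= C.
Proof.
move=> Sf l0; have [sf df dff] := proj1 (SomegaP f) Sf.
have rf := schwartz_crapid (proj1 Sf).
have [C hC] := twisted_translation_bound a r sf df l0.
have [D hD] := twisted_translation_bound a r (smooth_fourier rf) dff l0.
exists (Num.max C D) => z /coord_le_norm_pair[z1 z2] x; rewrite !le_max; split.
  by rewrite cmod_iter_pderiv_modulation_translation// hC.
rewrite fourier_phase_shift// cmod_iter_pderiv_translation_modulation; last first.
  exact: smooth_fourier.
by rewrite hD ?orbT// => i; rewrite mxE normrN.
Qed.

Lemma Somega_phase_shift z f : Somega omega f -> Somega omega (phase_shift z f).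
Proof.
move=> Sf; apply/SomegaP; have [sf _ _] := proj1 (SomegaP f) Sf; split.
- by apply: smooth_modulation; exact: smooth_translation.
- move=> lambda a l0; have [C hC] := phase_shift_decay a `|z| Sf l0.
  by exists C => x; have [] := hC z (lexx _) x.
- move=> lambda a l0; have [C hC] := phase_shift_decay a `|z| Sf l0.
  by exists C => x; have [] := hC z (lexx _) x.
Qed.

Lemma iter_pderivZ c f s : smooth f ->
  iter_pderiv s (fun x => c * f x) = (fun x => c * iter_pderiv s f x).
Proof.
move=> sf; rewrite -[LHS](_ : iter_pderiv s (fun x => (c - 1) * f x + f x) = _).
  by rewrite iter_pderiv_lin//; apply/funext => x; rewrite mulrBl mul1r subrK.
by congr iter_pderiv; apply/funext => x; rewrite mulrBl mul1r subrK.
Qed.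

Lemma SomegaZ c f : Somega omega f -> Somega omega (fun x => c * f x).
Proof.
move=> Sf; have [sf df dff] := proj1 (SomegaP f) Sf.
have rf := schwartz_crapid (proj1 Sf).
have dZ g : smooth g -> weight_decay g -> weight_decay (fun x => c * g x).
  move=> sg dg lambda a l0; have [C hC] := dg lambda a l0; exists (cmod c * C) => x.
  by rewrite iter_pderivZ// cmodM mulrCA ler_wpM2l ?cmod_ge0.
apply/SomegaP; split; last 2 first.
- exact: dZ.
- by rewrite fourierZ//; apply: dZ => //; exact: smooth_fourier.
have := smooth_lin (c - 1) sf sf; congr smooth; apply/funext => x.
by rewrite mulrBl mul1r subrK.
Qed.

Variable u : ('rV[R]_d -> R[i]) -> R[i].
Hypothesis hu : Somega_dual omega u.

Lemma Somega_dualZ c f : Somega omega f -> u (fun x => c * f x) = (c^*)%R * u f.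
Proof.
move=> Sf; have := proj1 hu (c - 1) f f Sf Sf.
rewrite rmorphB rmorph1 mulrBl mul1r subrK => <-.
by congr u; apply/funext => x; rewrite mulrBl mul1r subrK.
Qed.

(** A small multiple c of the shifted window lies, for all |z| <= r at once, in a neighbourhood of
    zero where u varies by less than 1; division by c gives the bound. *)
Lemma stft_bounded phi r : Somega omega phi ->
  exists B, forall z, `|z| <= r -> cmod (stft phi u z) <= B.
Proof.
move=> Sphi; have S0 := SomegaZ 0 Sphi; set zero := (fun x => 0 * phi x) in S0.
have [J [delta [delta0 J0 hJ]]] := proj2 hu _ S0 1 ltr01.
have [C hC] : exists C, forall z, `|z| <= r -> forall j, j \in J -> forall x,
    expR (j.1 * omega (enorm x)) *
      cmod (iter_pderiv (multi_index_seq j.2) (phase_shift z phi) x) <= C /\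
    expR (j.1 * omega (enorm x)) *
      cmod (iter_pderiv (multi_index_seq j.2) (fourier (phase_shift z phi)) x) <= C.
  elim: J J0 {hJ} => [|j J IHJ] J0; first by exists 0.
  have [|C hC] := IHJ; first by move=> k kJ; apply: J0; rewrite inE kJ orbT.
  have [D hD] := phase_shift_decay j.2 r Sphi (J0 j (mem_head _ _)).
  exists (Num.max C D) => z zr k; rewrite inE => /predU1P[->|kJ] x; rewrite !le_max.
    by have [-> ->] := hD z zr x; rewrite !orbT.
  by have [-> ->] := hC z zr k kJ x.
have C0 : 0 < `|C| + 1 by rewrite ltr_wpDl.
(* The factor 1/2 keeps c C strictly below delta. *)
pose c := delta / 2 / (`|C| + 1).
have c0 : 0 < c by rewrite !divr_gt0.
have cC : c * C < delta.
  rewrite (@le_lt_trans _ _ (c * (`|C| + 1)))//.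
    by rewrite ler_wpM2l ?(ltW c0)// (le_trans (ler_norm _))// lerDl.
  by rewrite /c divfK ?gt_eqF// ltr_pdivrMr// ltr_pMr// ltr1n.
exists ((1 + cmod (u zero)) / c) => z zr.
have SP := Somega_phase_shift z Sphi.
have [sP _ _] := proj1 (SomegaP _) SP; have rP := schwartz_crapid (proj1 SP).
have lt1 : cmod (u (fun x => c%:C * phase_shift z phi x) - u zero) < 1.
  apply: hJ; first exact: SomegaZ.
  under eq_fun do rewrite /zero mul0r subr0.
  have cbound g C' lambda a : smooth g -> (forall x, expR (lambda * omega (enorm x)) *
      cmod (iter_pderiv (multi_index_seq a) g x) <= C') ->
      (wseminorm omega lambda a (fun x => c%:C * g x)%R <= (c * C')%:E)%E.
    move=> sg hg; apply: wseminorm_le => x.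
    by rewrite iter_pderivZ// cmodM cmod_real gtr0_norm// mulrCA ler_wpM2l// ltW.
  move=> j jJ; split.
    apply: (@le_lt_trans _ _ (c * C)%:E); last by rewrite lte_fin.
    by apply: cbound => // x; have [] := hC z zr j jJ x.
  rewrite fourierZ//; apply: (@le_lt_trans _ _ (c * C)%:E); last by rewrite lte_fin.
  apply: cbound; first exact: smooth_fourier.
  by move=> x; have [] := hC z zr j jJ x.
rewrite ler_pdivlMr// /stft mulrC -[c in leLHS]gtr0_norm// -cmod_real -(cmod_conj c%:C).
rewrite -cmodM -Somega_dualZ// -[X in cmod X](subrK (u zero)).
by rewrite (le_trans (cmodD _ _))// lerD2r ltW.
Qed.

(** Moving T_(-y) past the modulations leaves a phase that is constant in x; conjugate linearity
    takes it out of u, and it has modulus 1. *)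
Lemma stft_phase_shift_dual phi y eta z : Somega omega phi ->
  cmod (stft phi (phase_shift_dual (y, eta) u) z) = cmod (stft phi u (z - (y, eta))).
Proof.
move=> Sphi; have SP := Somega_phase_shift (z - (y, eta)) Sphi.
rewrite /stft /phase_shift_dual /modulation_dual /translation_dual /=.
have -> : translation (- y) (modulation (- eta) (phase_shift z phi)) =
    (fun x => cexpi (dotp y (z.2 - eta)) * phase_shift (z - (y, eta)) phi x).
  apply/funext => x; rewrite /translation /phase_shift /modulation /translation /=.
  rewrite !mulrA -!cexpiD opprK; congr (cexpi _ * phi _).
    by rewrite -!dotpDr !dotpDl addrC [- eta + _]addrC.
  by rewrite opprB addrA [x + y - _]addrAC -addrA.
by rewrite Somega_dualZ// cmodM cmod_conj cmod_cexpi mul1r.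
Qed.

End PhaseShifts.

(** * Invariance of the wave front set *)

Section WaveFront.
Context {R : realType} {d : nat}.
Variable omega : R -> R.
Hypothesis homega : nonquasianalytic_subadditive_weight omega.
Implicit Types (F : 'rV[R]_d * 'rV[R]_d -> R) (z : 'rV[R]_d * 'rV[R]_d).

(** The condition that [WF'] negates, for an arbitrary function so that it can be translated. *)
Definition conic_decay F z0 := exists G : set ('rV[R]_d * 'rV[R]_d),
  [/\ open G, conic G, ~ G 0, G z0 &
    forall lambda : R, 0 < lambda ->
      (ereal_sup [set (expR (lambda * omega (enorm2 z)) * F z)%:E | z in G] < +oo)%E].

(** Balls are those of the sup norm while the weight uses the Euclidean norm; [wB] reconciles the
    two. *)
Lemma conic_decay_translate F z0 z1 : (forall z, 0 <= F z) ->
  (forall r, exists B, forall z, `|z| <= r -> F z <= B) ->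
  conic_decay F z0 -> conic_decay (fun z => F (z - z1)) z0.
Proof.
move=> F0 FB [G [oG cG G0 Gz0 dec]].
have wD z z' : omega (enorm2 (z + z')) <= omega (enorm2 z) + omega (enorm2 z').
  by rewrite !enorm2E /= -add_row_mx weight_enormD.
have wB r : exists B, forall z, `|z| <= r -> omega (enorm2 z) <= B.
  have [B hB] := weight_enorm_bounded homega (d + d) r; exists B => z.
  move=> /coord_le_norm_pair[z1r z2r]; rewrite enorm2E; apply: hB => i.
  by rewrite mxE; case: (fintype.split i) => k.
have dec' lambda : 0 < lambda ->
    exists C, forall z, G z -> expR (lambda * omega (enorm2 z)) * F z <= C.
  by move=> l0; apply/ereal_sup_EFin_ltyP; exact: dec.
have [G' [oG' cG' G'0 G'z0 dec'']] := @conic_decay_shift _ _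
  (fun z => omega (enorm2 z)) F G z0 z1 wD wB F0 FB oG cG G0 Gz0 dec'.
exists G'; split=> // lambda l0; apply/ereal_sup_EFin_ltyP; exact: dec''.
Qed.

End WaveFront.

Theorem proposition3p19 (R : realType) (d : nat) (omega : R -> R)
    (homega : nonquasianalytic_subadditive_weight omega)
    (phi : 'rV[R]_d -> R[i]) (hphi : window omega phi)
    (y eta : 'rV[R]_d) (u : ('rV[R]_d -> R[i]) -> R[i])
    (hu : Somega_dual omega u) :
  WF' omega phi (phase_shift_dual (y, eta) u) = WF' omega phi u.
Proof.
have Sphi := proj1 hphi.
pose F z := cmod (stft phi u z).
have F0 z : 0 <= F z by exact: cmod_ge0.
have FB r : exists B, forall z, `|z| <= r -> F z <= B.
  exact: (stft_bounded homega hu).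
have FwE : (fun z => cmod (stft phi (phase_shift_dual (y, eta) u) z)) =
    (fun z => F (z - (y, eta))).
  by apply/funext => z; exact: (stft_phase_shift_dual homega hu).
have FwB r : exists B, forall z, `|z| <= r -> F (z - (y, eta)) <= B.
  have [B hB] := FB (r + `|(y, eta)|); exists B => z zr; apply: hB.
  by rewrite (le_trans (ler_normB _ _))// lerD2r.
have iff z0 : conic_decay omega F z0 <->
    conic_decay omega (fun z => cmod (stft phi (phase_shift_dual (y, eta) u) z)) z0.
  rewrite FwE; split; first exact: conic_decay_translate.
  (* The shifted function is translated back by w, its local boundedness being [FwB]. *)
  move/(conic_decay_translate homega (- (y, eta)) (fun z => F0 _) FwB).
  by congr conic_decay; apply/funext => z; rewrite opprK addrK.
apply/seteqP; split=> z0 [z00 nG]; split=> // h; apply: nG; exact/iff.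
Qed.
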